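(* Let $K\subset\mathbb{R}^n$ be a convex body with $0\in K$ and let $H$ be a $k$-dimensional linear subspace of $\mathbb{R}^n$. Then $$\mathcal{W}(P_HK)\,\mathcal{W}(K\cap H^{\perp})\leq\min\left\{\binom{n}{k}\mathcal{W}(K),\;2^{n/2}\,\mathcal{W}\bigl(\sqrt{2}\,K\bigr)\right\},$$ where $\mathcal{W}$ is the Wills functional.
   Context: A convex body in $\mathbb{R}^n$ is a non-empty compact convex set; $\mathrm{vol}$ is $n$-dimensional Lebesgue measure. $P_HK$ is the orthogonal projection of $K$ onto $H$ and $H^\perp$ the orthogonal complement of $H$. With $B_2^n$ the Euclidean unit ball and $\kappa_j=\mathrm{vol}_j(B_2^j)=\pi^{j/2}/\Gamma(j/2+1)$, the intrinsic volumes $\mathrm{V}_i(K)$, $0\le i\le n$, of a convex body $K$ are defined by the Steiner formula $\mathrm{vol}(K+\lambda B_2^n)=\sum_{i=0}^n\kappa_{n-i}\mathrm{V}_i(K)\lambda^{n-i}$ for all $\lambda\geq 0$. The Wills functional is $\mathcal{W}(K)=\sum_{i=0}^n\mathrm{V}_i(K)$; equivalently, $\mathcal{W}(K)=\int_{\mathbb{R}^n}e^{-\pi d(x,K)^2}\,dx$, where $d(x,K)$ is the Euclidean distance from $x$ to $K$. The value $\mathcal{W}(K)$ does not depend on the dimension of the Euclidean space in which $K$ is embedded. *)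

(* Defs.v *)
From HB Require Import structures.
From mathcomp Require Import all_boot all_order all_algebra.
From mathcomp Require Import all_classical all_reals all_analysis.

Set Implicit Arguments.
Unset Strict Implicit.
Unset Printing Implicit Defensive.

Import Order.TTheory GRing.Theory Num.Theory.
Import numFieldNormedType.Exports.

Local Open Scope classical_set_scope.
Local Open Scope ring_scope.

Section Euclidean.
Context {R : realType} {n : nat}.
Implicit Types (K : set 'rV[R]_n) (H : {vspace 'rV[R]_n}).

(* The library norm on 'rV_n is the sup norm, hence an explicit inner product
   for the Euclidean notions. Both norms induce the same topology, so
   [compact] below is the usual compactness in R^n. *)
Definition dot (u v : 'rV[R]_n) : R := \sum_i u ord0 i * v ord0 i.

Definition euclid_norm (u : 'rV[R]_n) : R := Num.sqrt (dot u u).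

Definition unit_ball : set 'rV[R]_n := [set x | euclid_norm x <= 1].

Definition convex_body K : Prop := [/\ K !=set0, compact K & convex_set K].

Definition ortho_compl H : set 'rV[R]_n :=
  [set x | forall h, h \in H -> dot x h = 0].

(* The orthogonal projection of x onto H is the unique y in H such that x - y
   is orthogonal to H. *)
Definition ortho_proj H K : set 'rV[R]_n :=
  [set y | y \in H /\ exists2 x, K x & ortho_compl H (x - y)].

Definition dilate (c : R) K : set 'rV[R]_n := [set c *: x | x in K].

Definition parallel_body K (c : R) : set 'rV[R]_n :=
  [set x + c *: b | x in K & b in unit_ball].

End Euclidean.

Arguments unit_ball R n : clear implicits.

(* n-dimensional Lebesgue measure, as the iterated product of the
   one-dimensional one: R^(n+1) is split into its first coordinate t and the
   remaining n coordinates, as in [product_measure1]. On R^0 = {0} it is the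
   unit mass at the point. It is meant for Borel sets. *)
Fixpoint vol {R : realType} (n : nat) : set 'rV[R]_n -> \bar R :=
  match n return set 'rV[R]_n -> \bar R with
  | 0 => fun A => (\1_A 0)%:E
  | n'.+1 => fun A => (\int[lebesgue_measure]_t
      vol [set v : 'rV[R]_n' | A (row_mx (t%:M : 'rV[R]_1) v)])%E
  end.

Definition kappa {R : realType} (j : nat) : R := fine (vol (unit_ball R j)).

Definition steiner_formula {R : realType} {n : nat} (K : set 'rV[R]_n)
    (V : 'I_n.+1 -> R) : Prop :=
  forall c : R, 0 <= c ->
    vol (parallel_body K c) =
    (\sum_(i < n.+1) kappa (n - i) * V i * c ^+ (n - i))%:E.

(* The Steiner formula determines the V_i, the kappa_j being positive. *)
Definition intrinsic_volume {R : realType} {n : nat} (K : set 'rV[R]_n) :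
  'I_n.+1 -> R := get [set V | steiner_formula K V].

(* For K contained in a proper subspace the intrinsic volumes are still those
   computed in the ambient R^n; they do not depend on the embedding. *)
Definition wills {R : realType} {n : nat} (K : set 'rV[R]_n) : R :=
  \sum_(i < n.+1) intrinsic_volume K i.

(* Main.v *)
From HB Require Import structures.
Require Import Defs.
From mathcomp Require Import all_boot all_order all_algebra.
From mathcomp Require Import all_classical all_reals all_analysis.
From mathcomp Require Import measurable_realfun ring lra.

(* The Wills functional is an average of volumes of parallel bodies. By the
   layer-cake formula the integral of exp (- pi d(x, K)^2) equals the integral
   over s in ]0, 1[ of vol (K + r(s) B), with r(s)^2 = - ln s / pi; for K = {0}
   in R^j this says that kappa_j r(s)^j has mean 1, so the Steiner formula turns
   the average into the sum of the intrinsic volumes.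

   First bound: for each radius r, the Rogers-Shephard inequality for K + r B
   gives vol (P_H K + r B) vol (K \cap H^perp + r B) <= C(n, k) vol (K + r B).
   Both factors on the left increase with r, so by Chebyshev's association
   inequality the product of their means is at most the mean of the product.

   Second bound: if p is the point of P_H K nearest to y, lifted to (p, w) in K,
   and q is the point of the section nearest to z, then (p, w) + (0, q) lies in
   2 K, whence d((y, z + w), 2 K)^2 <= d(y, P_H K)^2 + d(z, K \cap H^perp)^2.
   Integrating first in z, where the shift by w is harmless, bounds the product
   by the Wills functional of 2 K, and 2 K + r B is contained in
   sqrt 2 (sqrt 2 K + r B).

   The Steiner formula itself: vol (K + c S) is affine in c for a segment S, hence
   polynomial for a zonotope, and the ball is a limit of zonotopes because the
   average over g in B of |<x, g>| is a multiple of |x|. *)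

Set Implicit Arguments.
Unset Strict Implicit.
Unset Printing Implicit Defensive.

Import Order.TTheory GRing.Theory Num.Theory.
Import numFieldNormedType.Exports.

Local Open Scope classical_set_scope.
Local Open Scope ring_scope.

(** * Lebesgue measure on row vectors *)

(** [wills] is defined through [get], so nothing is known about it until some family is shown to
    satisfy the Steiner formula; hence the proof that parallel volumes are polynomial. Afterwards
    all work is done on [gauss_wills], an integral of volumes, to which inclusions and Tonelli
    apply. There a factor [{0}] contributes the factor 1, which reconciles [wills] of the projection
    and of the section, both taken in the ambient space, with integrals over R^k and R^m. [vol] is
    only an iterated integral along the axes. Its behaviour under dilations and rotations comes from
    the uniqueness of translation-invariant measures, without determinants. The binomial coefficient
    is the reciprocal of a beta integral: over a point of [s P], with P the projection, the volume
    of the fibre is at least [(1 - s)^m] times that of the central one, while [s P] has volume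
    proportional to [s^k]. The body [sqrt 2 K] appears because convexity only places the sum of two
    points of K in [2 K]; taking a factor [sqrt 2] out of the whole parallel body costs the volume
    ratio [2^(n/2)]. *)

Section measurable_rV.
Context {R : realType} {n : nat}.
Let coord (i : 'I_n) (x : 'rV[R]_n) : measurableTypeR R := x ord0 i.

(** The product sigma-algebra: coordinates and [row_cons] are then measurable by construction, and
    [open_measurable_rV] shows later that it contains the Borel sets. *)
Definition measurable_rV : set (set 'rV[R]_n) := g_sigma_preimage coord.

Let rV_set0 : measurable_rV set0.
Proof. exact: sigma_algebra0. Qed.

Let rV_setC A : measurable_rV A -> measurable_rV (~` A).
Proof. exact: sigma_algebraC. Qed.

Let rV_bigcup (F : _^nat) : (forall i, measurable_rV (F i)) ->
  measurable_rV (\bigcup_i (F i)).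
Proof. exact: sigma_algebra_bigcup. Qed.

Fact rV_display : measure_display. Proof. exact: default_measure_display. Qed.

HB.instance Definition _ := @isMeasurable.Build rV_display
  'rV[R]_n measurable_rV rV_set0 rV_setC rV_bigcup.

Lemma measurable_coord (i : 'I_n) :
  measurable_fun [set: 'rV[R]_n] (fun x => x ord0 i).
Proof.
move=> _ Y mY; rewrite setTI; apply: sub_sigma_algebra => /=.
rewrite -bigcup_seq/=; exists i => /=; first by rewrite mem_index_enum.
by exists Y => //; rewrite setTI.
Qed.

Lemma measurable_fun_rV d (T : measurableType d) (f : T -> 'rV[R]_n) :
  (forall i, measurable_fun [set: T] (fun x => f x ord0 i)) ->
  measurable_fun [set: T] f.
Proof.
move=> mf _ A mA.
have : g_sigma_preimage (fun i => coord i \o f) (f @^-1` A).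
  rewrite g_sigma_preimage_comp.
  by exists A => //; rewrite setTI.
rewrite setTI; apply: smallest_sub; first exact: sigma_algebra_measurable.
rewrite -bigcup_seq; apply: bigcup_sub => i _ B [C mC <-].
exact: mf.
Qed.

End measurable_rV.

(** * The iterated integral [vol] as a sigma-finite measure *)

Section vol_measure.
Context {R : realType}.
Implicit Types n : nat.
Notation leb := (@lebesgue_measure R).
Notation mR := (measurableTypeR R).

Definition row_cons n (p : mR * 'rV[R]_n) : 'rV[R]_n.+1 :=
  row_mx (p.1%:M : 'rV[R]_1) p.2.

Lemma row_cons0 n (p : mR * 'rV[R]_n) : row_cons p ord0 ord0 = p.1.
Proof.
rewrite /row_cons mxE; case: splitP => [j|k] //=.
by rewrite ord1 mxE eqxx mulr1n.
Qed.

Lemma row_consS n (p : mR * 'rV[R]_n) i : row_cons p ord0 (lift ord0 i) = p.2 ord0 i.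
Proof.
rewrite /row_cons mxE; case: splitP => [j|k] /= => [/eqP|/eqP].
  by rewrite ord1.
by rewrite /bump leq0n add1n eqSS => /eqP /val_inj ->.
Qed.

Lemma row_consE n (x : 'rV[R]_n.+1) :
  x = row_cons (x ord0 ord0, \row_i x ord0 (lift ord0 i)).
Proof.
apply/rowP => i; have [j ->|->] := unliftP ord0 i; last by rewrite row_cons0.
by rewrite row_consS mxE.
Qed.

Lemma measurable_row_cons n : measurable_fun [set: mR * 'rV[R]_n] (@row_cons n).
Proof.
apply: measurable_fun_rV => i; have [j ->|->] := unliftP ord0 i; last first.
  by under eq_fun do rewrite row_cons0; exact: measurable_fst.
under eq_fun do rewrite row_consS.
by apply: (measurableT_comp (measurable_coord j)); exact: measurable_snd.
Qed.

(** One step of the fixpoint is a product measure carried over by [row_cons]; this gives access to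
    additivity and Tonelli. *)
Lemma volS_pushforward n :
  vol (n := n.+1) = pushforward (leb \x vol (n := n))%E (@row_cons n).
Proof.
apply/funext => A /=; rewrite /pushforward /product_measure1/=.
apply: eq_integral => t _ /=; congr vol.
by rewrite xsectionE.
Qed.

Lemma vol_set0 n : vol (set0 : set 'rV[R]_n) = 0%E.
Proof.
elim: n => [|n IH] /=; first by rewrite indicE in_set0.
by apply: integral0_eq => t _; rewrite -[RHS]IH.
Qed.

Lemma vol_ge0 n (A : set 'rV[R]_n) : (0 <= vol A)%E.
Proof.
elim: n A => [|n IH] A /=; first by rewrite lee_fin.
exact: integral_ge0.
Qed.

Definition cube n (a b : R) : set 'rV[R]_n := [set v | forall i, a <= v ord0 i <= b].
Arguments cube n a b : clear implicits.

Lemma vol_cube n (a b : R) : a <= b -> vol (cube n a b) = ((b - a) ^+ n)%:E.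
Proof.
move=> ab; elim: n => [|n IH].
  by rewrite /= indicE mem_set ?expr0// => -[].
rewrite volS_pushforward /pushforward /product_measure1.
rewrite (eq_integral (fun t : mR => ((b - a) ^+ n)%:E * (\1_(`[a, b]%classic) t)%:E)%E).
  rewrite ge0_integralZl//=; last first.
  - by rewrite lee_fin exprn_ge0// subr_ge0.
  - exact/measurable_EFinP.
  rewrite integral_indic// setIT.
  transitivity (((b - a) ^+ n)%:E * (b - a)%:E)%E; last by rewrite -EFinM -exprSr.
  congr (_ * _)%E; have := lebesgue_measure_itv `[a, b]; rewrite /= lte_fin => ->.
  by case: ltgtP ab => // -> _; rewrite subrr.
move=> t _ /=; rewrite xsectionE indicE.
have [tab|tab] := boolP (t \in `[a, b]).
  rewrite mem_set// mule1 -IH; congr vol; apply/seteqP; split => v /= h i.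
    by have := h (lift ord0 i); rewrite row_consS.
  have [j ->|->] := unliftP ord0 i; last by rewrite row_cons0.
  by rewrite row_consS.
rewrite memNset/= ?mule0; last exact/negP.
rewrite -[RHS](vol_set0 n); congr vol; apply/seteqP; split => v //= h.
have := h ord0; rewrite row_cons0/= => h0.
by move: tab; rewrite in_itv/= h0.
Qed.

Lemma measurable_cube n (a b : R) : measurable (cube n a b).
Proof.
have -> : cube n a b = \bigcap_(i in [set: 'I_n]) ((fun x => x ord0 i) @^-1` `[a, b]%classic).
  apply/seteqP; split => [x xab i _ /=|x xab i]; first by rewrite in_itv/= xab.
  by have := xab i Logic.I; rewrite /= in_itv.
apply: fin_bigcap_measurable => // i _.
rewrite -[X in measurable X]setTI; exact: measurable_coord.
Qed.

Lemma cube_cover n : \bigcup_(k : nat) cube n (- k%:R) k%:R = [set: 'rV[R]_n].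
Proof.
apply/seteqP; split => // x _.
exists (Num.truncn (\sum_i `|x ord0 i|)).+1 => // i.
rewrite -ler_norml (le_trans _ (ltW (truncnS_gt _)))//.
by rewrite (bigD1 i)//= lerDl sumr_ge0.
Qed.

Lemma vol_sigma_additive_finite n :
  semi_sigma_additive (@vol R n) /\ sigma_finite setT (@vol R n).
Proof.
split; last first.
  exists (fun k => cube n (- k%:R) k%:R); first by rewrite cube_cover.
  move=> k; split; first exact: measurable_cube.
  by rewrite vol_cube ?ltry// (@le_trans _ _ 0) ?oppr_le0.
elim: n => [|n IH].
  have -> : vol (R := R) (n := 0) = @dirac _ 'rV[R]_0 0 R by [].
  exact: measure_semi_sigma_additive.
(* The product measure can only be formed with a packed sigma-finite factor, and in dimension [n]
   this structure exists only within the induction. The cubes supply sigma-finiteness. *)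
pose m1 := isMeasure.Build _ _ R (@vol R n) (vol_set0 n) (@vol_ge0 n) IH.
pose m2 := HB.pack_for (Measure.type 'rV[R]_n R) (@vol R n) m1.
have sf : sigma_finite setT m2.
  exists (fun k => cube n (- k%:R) k%:R); first by rewrite cube_cover.
  move=> k; split; first exact: measurable_cube.
  by rewrite /= vol_cube ?ltry// (@le_trans _ _ 0) ?oppr_le0.
pose m3 := @Measure_isSigmaFinite.Build _ _ _ m2 sf.
pose m4 := HB.pack_for (SigmaFiniteMeasure.type 'rV[R]_n R) (@vol R n) m1 m3.
rewrite volS_pushforward => F mF tF mUF; rewrite /pushforward preimage_bigcup.
have mc (A : set 'rV[R]_n.+1) : measurable A -> measurable (@row_cons n @^-1` A).
  by move=> mA; rewrite -[X in measurable X]setTI; exact: measurable_row_cons.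
apply: (@measure_semi_sigma_additive _ _ _ (leb \x m4)%E).
- by move=> k; exact: mc.
- apply/trivIsetP => /= i j _ _ ij; rewrite -preimage_setI.
  by move/trivIsetP : tF => /(_ _ _ _ _ ij) ->//; rewrite preimage_set0.
- by rewrite -preimage_bigcup; exact: mc.
Qed.

HB.instance Definition _ n := isMeasure.Build _ _ R (@vol R n)
  (vol_set0 n) (@vol_ge0 n) (vol_sigma_additive_finite n).1.
HB.instance Definition _ n := @Measure_isSigmaFinite.Build _ _ _ (@vol R n)
  (vol_sigma_additive_finite n).2.

End vol_measure.
Arguments cube {R} n a b.

Section vol_theory.
Context {R : realType}.
Implicit Types n k m : nat.
Notation leb := (@lebesgue_measure R).
Notation mR := (measurableTypeR R).

Lemma integral_volS n (f : 'rV[R]_n.+1 -> \bar R) :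
  measurable_fun setT f -> (forall x, 0 <= f x)%E ->
  (\int[vol (n := n.+1)]_x f x =
   \int[leb]_t \int[vol (n := n)]_v f (row_cons (t, v)))%E.
Proof.
move=> mf f0.
transitivity (\int[pushforward (leb \x @vol R n) (@row_cons R n)]_x f x)%E.
  by rewrite volS_pushforward.
rewrite (ge0_integral_pushforward (@measurable_row_cons R n))//.
rewrite preimage_setT (fubini_tonelli1 (f \o @row_cons R n))//.
  exact: measurableT_comp (measurable_row_cons (n := n)).
by move=> x; exact: f0.
Qed.

Lemma measurable_row_mx k m :
  measurable_fun [set: 'rV[R]_k * 'rV[R]_m] (fun p => row_mx p.1 p.2).
Proof.
apply: measurable_fun_rV => i; under eq_fun do rewrite mxE.
case: (fintype.split i) => j.
  exact: (measurableT_comp (measurable_coord j) measurable_fst).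
exact: (measurableT_comp (measurable_coord j) measurable_snd).
Qed.

Lemma integral_vol_row_mx k m (f : 'rV[R]_(k + m) -> \bar R) :
  measurable_fun setT f -> (forall x, 0 <= f x)%E ->
  (\int[vol (n := (k + m)%N)]_x f x =
   \int[vol (n := k)]_y \int[vol (n := m)]_z f (row_mx y z))%E.
Proof.
elim: k f => [|k IH] f mf f0.
  transitivity (\int[@dirac _ 'rV[R]_0 (0%R : 'rV[R]_0) R]_y \int[vol (n := m)]_z f (row_mx y z))%E;
    last by apply: eq_measure_integral.
  rewrite integral_dirac//; last first.
    apply: (@measurable_fun_fubini_tonelli_F _ _ _ _ _ (@vol R m)
      (fun p => f (row_mx p.1 p.2))) => //.
    by apply: (measurableT_comp mf); exact: measurable_row_mx.
  rewrite diracT mul1e; apply: eq_integral => z _; congr f.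
  apply/rowP => i; rewrite mxE; case: splitP => [[]//|j ij].
  by congr (z _ _); exact/val_inj.
have mf' : measurable_fun [set: 'rV[R]_k.+1 * 'rV[R]_m] (fun p => f (row_mx p.1 p.2)).
  by apply: (measurableT_comp mf); exact: measurable_row_mx.
have -> := integral_volS (n := (k + m)%N) mf f0.
rewrite integral_volS//; last 2 first.
- exact: (@measurable_fun_fubini_tonelli_F _ _ _ _ _ (@vol R m) _ mf').
- by move=> x; exact: integral_ge0.
apply: eq_integral => t _; rewrite IH//; last first.
  apply: (measurableT_comp mf).
  apply: (measurableT_comp (measurable_row_cons (n := (k + m)%N))).
  exact: measurable_pair1.
apply: eq_integral => y _; apply: eq_integral => z _; congr f.
(* What is left is associativity of concatenation: putting [t] in front of [row_mx y z], or in front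
   of [y] before appending [z]. *)
apply/rowP => i; rewrite -[LHS]/(row_cons (t, row_mx y z) ord0 i).
have [j ->|->] := unliftP (ord0 : 'I_(k + m).+1) i; last first.
  rewrite row_cons0 mxE; case: splitP => [j /esym j0|//].
  by rewrite (_ : j = ord0) ?row_cons0//; exact/val_inj.
rewrite row_consS !mxE; case: splitP => [a ja|a ja]; case: splitP => [b|b] /=.
- rewrite /bump leq0n add1n => jb; rewrite (_ : b = lift ord0 a) ?row_consS//.
  by apply/val_inj; rewrite /= /bump leq0n add1n -ja.
- rewrite /bump leq0n add1n ja => jb; have := ltn_ord a.
  by move: jb; rewrite addSn => -[->]; rewrite ltnNge leq_addr.
- rewrite /bump leq0n add1n ja => jb; have := ltn_ord b.
  by rewrite -jb !ltnS ltnNge leq_addr.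
- rewrite /bump leq0n add1n ja addSn => -[/addnI ab].
  by congr (z _ _); exact/val_inj.
Qed.

(** Both sides compute the product measure of [D]. *)
Lemma vol_sections d (T : measurableType d) n
    (mu : {sigma_finite_measure set T -> \bar R})
    (nu : {sigma_finite_measure set 'rV[R]_n -> \bar R}) (D : set (T * 'rV[R]_n)) :
  measurable D ->
  (\int[mu]_x nu [set y | D (x, y)] = \int[nu]_y mu [set x | D (x, y)])%E.
Proof.
move=> mD; have := @indic_fubini_tonelli _ _ _ _ R mu nu _ mD.
rewrite indic_fubini_tonelli_FE// indic_fubini_tonelli_GE//= => h.
etransitivity; last (etransitivity; first exact: h).
  by apply: eq_integral => x _; rewrite xsectionE.
by apply: eq_integral => x _; rewrite ysectionE.
Qed.

(** Lebesgue measure is characterised by its values on the intervals []x, y]], and the shift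
    preserves their lengths. *)
Lemma lebesgue_measure_shift (a : R) (A : set mR) : measurable A ->
  leb [set t | A (t + a)] = leb A.
Proof.
move=> mA; have ms : measurable_fun [set: mR] (fun t : mR => (t + a : mR)).
  exact: measurable_funD.
apply/esym.
apply: (lebesgue_measure_unique (mu := pushforward leb (fun t : mR => (t + a : mR)))) => //.
move=> _ [[x y] _ <-] /=; rewrite /pushforward.
have -> : (fun t : mR => (t + a : mR)) @^-1` `]x, y]%classic = `]x - a, y - a]%classic.
  apply/seteqP; split => t /=; rewrite !in_itv/=; lra.
rewrite !lebesgue_measure_itv/= !lte_fin ltrD2r; case: ifP => // _.
by rewrite -!EFinB; congr EFin; lra.
Qed.

End vol_theory.

(** * Translation invariance, uniqueness, and linear changes of variables *)

Section vol_invariance.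
Context {R : realType}.
Implicit Types n k m : nat.
Notation leb := (@lebesgue_measure R).
Notation mR := (measurableTypeR R).

Lemma measurable_preimage d1 d2 (T1 : measurableType d1) (T2 : measurableType d2)
    (f : T1 -> T2) (A : set T2) :
  measurable_fun setT f -> measurable A -> measurable [set x | A (f x)].
Proof. by move=> mf mA; rewrite -[X in measurable X]setTI; exact: mf. Qed.

Lemma measurable_addrV d n (T : measurableType d) (f g : T -> 'rV[R]_n) :
  measurable_fun setT f -> measurable_fun setT g ->
  measurable_fun setT (fun x => f x + g x).
Proof.
move=> mf mg; apply: measurable_fun_rV => i; under eq_fun do rewrite mxE.
by apply: measurable_funD; apply: measurableT_comp (measurable_coord i) _.
Qed.

Lemma measurable_opprV d n (T : measurableType d) (f : T -> 'rV[R]_n) :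
  measurable_fun setT f -> measurable_fun setT (fun x => - f x).
Proof.
move=> mf; apply: measurable_fun_rV => i; under eq_fun do rewrite mxE.
by apply: measurableT_comp => //; exact: measurableT_comp (measurable_coord i) mf.
Qed.

Lemma measurable_scalerV d n (T : measurableType d) (c : T -> R) (f : T -> 'rV[R]_n) :
  measurable_fun setT c -> measurable_fun setT f ->
  measurable_fun setT (fun x => c x *: f x).
Proof.
move=> mc mf; apply: measurable_fun_rV => i; under eq_fun do rewrite mxE.
by apply: measurable_funM => //; exact: measurableT_comp (measurable_coord i) mf.
Qed.

Lemma measurable_mulmxr n k (U : 'M[R]_(n, k)) :
  measurable_fun [set: 'rV[R]_n] (fun x => x *m U).
Proof.
apply: measurable_fun_rV => i; under eq_fun do rewrite mxE.
apply: measurable_sum => j; apply: measurable_funM => //.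
exact: measurable_coord.
Qed.

Lemma vol_translate n (a : 'rV[R]_n) (A : set 'rV[R]_n) : measurable A ->
  vol [set x | A (x + a)] = vol A.
Proof.
elim: n a A => [|n IH] a A mA.
  by congr vol; apply/seteqP; split => x /=; rewrite (thinmx0 x) (thinmx0 a) ?addr0.
have rowD t (v : 'rV[R]_n) :
    row_cons (t, v) + a = row_cons (t + a ord0 ord0, v + \row_i a ord0 (lift ord0 i)).
  apply/rowP => i; rewrite mxE; have [j ->|->] := unliftP ord0 i.
    by rewrite !row_consS !mxE.
  by rewrite !row_cons0.
pose G t := vol [set v : 'rV[R]_n | A (row_cons (t, v))].
have mAt t : measurable [set v : 'rV[R]_n | A (row_cons (t, v))].
  apply: measurable_preimage mA; apply: measurableT_comp (@measurable_row_cons R n) _.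
  exact: measurable_pair1.
have mG : measurable_fun [set: mR] G.
  have -> : G = @vol R n \o xsection (@row_cons R n @^-1` A).
    by apply/funext => t; rewrite /G /= xsectionE.
  by apply: measurable_fun_xsection; apply: measurable_preimage mA; exact: measurable_row_cons.
transitivity (\int[leb]_t G (t + a ord0 ord0)%R)%E.
  apply: eq_integral => t _ /=; rewrite /G -(IH (\row_i a ord0 (lift ord0 i)))//.
  by congr vol; apply/seteqP; split => v /=; rewrite -rowD.
have ms : measurable_fun [set: mR] (fun t : mR => (t + a ord0 ord0 : mR)).
  exact: measurable_funD.
have <- := ge0_integral_pushforward ms leb (D := setT) measurableT mG; last by move=> t _; exact: vol_ge0.
by apply: eq_measure_integral => B mB _; exact: lebesgue_measure_shift.
Qed.

Definition translation_invariant n (mu : set 'rV[R]_n -> \bar R) :=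
  forall (a : 'rV[R]_n) (A : set 'rV[R]_n), measurable A -> mu [set x | A (x + a)] = mu A.

(** The uniqueness argument for Haar measure. The left side measures the pairs with [x] in [A] and
    [x + y] in [B]; shifting [x] by [- y] for fixed [y] turns them into the pairs with [x] in [B]
    and [x - y] in [A], and a shift of [y] for fixed [x] separates the variables again. *)
Lemma translation_invariant_exchange n
    (mu nu : {sigma_finite_measure set 'rV[R]_n -> \bar R}) (A B : set 'rV[R]_n) :
  translation_invariant mu -> translation_invariant nu ->
  measurable A -> measurable B ->
  (mu A * nu B = mu B * nu [set x | A (- x)%R])%E.
Proof.
move=> tmu tnu mA mB.
have mD : measurable_fun [set: 'rV[R]_n * 'rV[R]_n] (fun p => p.1 + p.2).
  by apply: measurable_addrV; [exact: measurable_fst|exact: measurable_snd].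
have mB' : measurable_fun [set: 'rV[R]_n * 'rV[R]_n] (fun p => p.1 - p.2).
  apply: measurable_addrV; first exact: measurable_fst.
  by apply: measurable_opprV; exact: measurable_snd.
have mprod (f : 'rV[R]_n * 'rV[R]_n -> 'rV[R]_n) (C D : set 'rV[R]_n) :
    measurable_fun setT f -> measurable C -> measurable D ->
    measurable [set p | C p.1 /\ D (f p)].
  move=> mf mC mD'; apply: measurableI.
    exact: (measurable_preimage (f := fst)).
  exact: measurable_preimage mD'.
have intC (m : {measure set 'rV[R]_n -> \bar R}) (C : set 'rV[R]_n) c :
    measurable C -> (0 <= c)%E ->
    (\int[m]_x ((\1_C x)%:E * c) = m C * c)%E.
  move=> mC c0; rewrite ge0_integralZr//=; first by rewrite integral_indic// setIT.
  exact/measurable_EFinP.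
have indM (m : {measure set 'rV[R]_n -> \bar R}) (P : set 'rV[R]_n) (Q : set 'rV[R]_n) x :
  ((\1_P x)%:E * m Q = m [set y | P x /\ Q y])%E.
  rewrite indicE; have [/set_mem Px|/negP Px] := boolP (x \in P).
    by rewrite mul1e; congr (m _); apply/seteqP; split => y //= -[].
  rewrite mul0e -(measure0 m); congr (m _); apply/seteqP; split => y //= -[Px' _].
  by apply: Px; rewrite inE.
transitivity (\int[mu]_x nu [set y | A x /\ B (x + y)%R])%E.
  rewrite -intC//; apply: eq_integral => x _.
  rewrite -indM; congr (_ * _)%E; rewrite -(tnu x)//.
  by congr (nu _); apply/seteqP; split => y /=; rewrite addrC.
rewrite (vol_sections mu nu (D := [set p | A p.1 /\ B (p.1 + p.2)]))/=; last exact: mprod.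
transitivity (\int[nu]_y mu [set x | B x /\ A (x - y)%R])%E.
  apply: eq_integral => y _; rewrite -[LHS](tmu (- y)).
    by congr (mu _); apply/seteqP; split => x /= []; rewrite ?subrK => ? ?; split; rewrite ?subrK.
  apply: measurableI => //; rewrite -[X in measurable X]/[set x | B (x + y)].
  apply: measurable_preimage mB.
  exact: measurable_addrV.
rewrite -(vol_sections mu nu (D := [set p | B p.1 /\ A (p.1 - p.2)]))/=; last exact: mprod.
rewrite -intC//.
apply: eq_integral => x _; rewrite -indM; congr (_ * _)%E.
rewrite -(tnu (- x)); last first.
  by apply: measurable_preimage mA; exact: measurable_opprV.
by congr (nu _); apply/seteqP; split => y /=; rewrite opprB.
Qed.

Lemma EFin_mulI (r : R) (x y : \bar R) : 0 < r -> (r%:E * x = r%:E * y -> x = y)%E.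
Proof.
move=> r0 xy; apply/eqP; rewrite eq_le -(@lee_pmul2l _ r%:E)//.
by rewrite xy lexx /= -(@lee_pmul2l _ r%:E)// xy.
Qed.

(** The exchange with both measures equal to [vol] and [B] a cube of positive finite volume, which
    can be cancelled. *)
Lemma vol_opp n (A : set 'rV[R]_n) : measurable A -> vol [set x | A (- x)] = vol A.
Proof.
move=> mA.
have : (vol A * vol (cube n (- 1) 1) = vol (cube n (- 1) 1) * vol [set x | A (- x)%R])%E.
  exact: (@translation_invariant_exchange n (@vol R n) (@vol R n) A (cube n (-1) 1)
    (@vol_translate n) (@vol_translate n) mA (@measurable_cube R n (-1) 1)).
rewrite vol_cube; last by lra.
rewrite [LHS]muleC => /esym.
by apply: EFin_mulI; rewrite exprn_gt0//; lra.
Qed.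

(** Proportionality is cross-multiplied, so that no value has to be finite or nonzero. *)
Lemma translation_invariant_unique n (mu : {sigma_finite_measure set 'rV[R]_n -> \bar R}) A B :
  translation_invariant mu -> measurable A -> measurable B ->
  (mu A * vol B = mu B * vol A)%E.
Proof.
move=> tmu mA mB; rewrite (@translation_invariant_exchange n mu (@vol R n) A B)//; last exact: vol_translate.
by congr (_ * _)%E; exact: vol_opp.
Qed.

(** The pushforward of [vol] by an additive bijection is again translation invariant, hence
    proportional to [vol]. A well-chosen [B] then determines the factor. *)
Lemma vol_additive_preimage n (f g : 'rV[R]_n -> 'rV[R]_n) (A B : set 'rV[R]_n) :
  measurable_fun setT f -> measurable_fun setT g -> cancel f g -> cancel g f ->
  {morph f : x y / x + y} -> measurable A -> measurable B ->
  (vol [set x | A (f x)] * vol B = vol [set x | B (f x)] * vol A)%E.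
Proof.
move=> mf mg fg gf fD mA mB.
have [p pE] : exists p : {measure set 'rV[R]_n -> \bar R},
    p = pushforward (@vol R n) f :> (set 'rV[R]_n -> \bar R).
  by unshelve eexists (pushforward (@vol R n) f).
(* The [g]-preimages of the cubes exhaust the space, and pulling them back by [f] returns the
   cubes. *)
have sf : sigma_finite setT p.
  exists (fun k => g @^-1` cube n (- k%:R) k%:R).
    by rewrite -preimage_bigcup cube_cover preimage_setT.
  move=> k; split; first by apply: measurable_preimage => //; exact: measurable_cube.
  rewrite pE /pushforward -comp_preimage.
  rewrite (_ : g \o f = id); last exact/funext.
  by rewrite preimage_id vol_cube ?ltry// (@le_trans _ _ 0) ?oppr_le0.
pose m1 := isSFinite.Build _ _ _ _ (sfinite_measure_sigma_finite sf).
pose m2 := isSigmaFinite.Build _ _ _ _ sf.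
pose q := HB.pack_for (SigmaFiniteMeasure.type 'rV[R]_n R) (Measure.sort p) m1 m2.
have qE C : q C = vol [set x | C (f x)] by rewrite [LHS](congr1 (@^~ C) pE).
rewrite -!qE; apply: translation_invariant_unique => // a C mC.
rewrite !qE -[RHS](vol_translate (g a)); last exact: measurable_preimage mC.
by congr vol; apply/seteqP; split => x /=; rewrite fD gf.
Qed.

Lemma dilateE n (c : R) (A : set 'rV[R]_n) : c != 0 ->
  dilate c A = [set x | A (c^-1 *: x)].
Proof.
move=> c0; apply/seteqP; split => [_ [x Ax <-]|x Ax] /=.
  by rewrite scalerA mulVf// scale1r.
by exists (c^-1 *: x) => //; rewrite scalerA divff// scale1r.
Qed.

(** The factor is read off the unit cube, whose dilate is the cube of side [c]. *)
Lemma vol_dilate n (c : R) (A : set 'rV[R]_n) : 0 < c -> measurable A ->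
  vol (dilate c A) = ((c ^+ n)%:E * vol A)%E.
Proof.
move=> c0 mA; have c0' := lt0r_neq0 c0.
have ms (a : R) : measurable_fun [set: 'rV[R]_n] (fun x => a *: x).
  by apply: measurable_scalerV; [exact: measurable_cst|exact: measurable_id].
have := @vol_additive_preimage n ( *:%R c^-1) ( *:%R c) A (cube n 0 1)
  (ms _) (ms _) (scalerKV c0') (scalerK c0') (scalerDr _) mA (@measurable_cube _ _ _ _).
rewrite -!dilateE// vol_cube// subr0 expr1n mule1 => ->; congr (_ * _)%E.
rewrite -[c in RHS]subr0 -vol_cube ?ltW//; congr vol.
rewrite dilateE//; apply/seteqP; split => x /= h i; have := h i; rewrite mxE.
  by rewrite mulrC ler_pdivlMr// mul0r ler_pdivrMr// mul1r.
by rewrite mulrC ler_pdivlMr// mul0r ler_pdivrMr// mul1r.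
Qed.

End vol_invariance.

(** * Euclidean geometry *)

Section euclid.
Context {R : realType}.
Implicit Types n k m : nat.

Lemma dotE n (u v : 'rV[R]_n) : dot u v = (u *m v^T) ord0 ord0.
Proof. by rewrite mxE; apply: eq_bigr => i _; rewrite mxE. Qed.

Lemma dotC n (u v : 'rV[R]_n) : dot u v = dot v u.
Proof. by apply: eq_bigr => i _; rewrite mulrC. Qed.

Lemma dotDl n (u v w : 'rV[R]_n) : dot (u + v) w = dot u w + dot v w.
Proof. by rewrite !dotE mulmxDl mxE. Qed.

Lemma dotZl n c (u w : 'rV[R]_n) : dot (c *: u) w = c * dot u w.
Proof. by rewrite !dotE -scalemxAl mxE. Qed.

Lemma dotNl n (u w : 'rV[R]_n) : dot (- u) w = - dot u w.
Proof. by rewrite -scaleN1r dotZl mulN1r. Qed.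

Lemma dotDr n (u v w : 'rV[R]_n) : dot w (u + v) = dot w u + dot w v.
Proof. by rewrite dotC dotDl !(dotC w). Qed.

Lemma dotZr n c (u w : 'rV[R]_n) : dot w (c *: u) = c * dot w u.
Proof. by rewrite dotC dotZl (dotC w). Qed.

Lemma dotNr n (u w : 'rV[R]_n) : dot w (- u) = - dot w u.
Proof. by rewrite dotC dotNl (dotC w). Qed.

Lemma dot_ge0 n (u : 'rV[R]_n) : 0 <= dot u u.
Proof. by apply: sumr_ge0 => i _; rewrite -expr2 sqr_ge0. Qed.

Lemma dot0l n (u : 'rV[R]_n) : dot 0 u = 0.
Proof. by rewrite dotE mul0mx mxE. Qed.

Lemma dot_eq0 n (u : 'rV[R]_n) : (dot u u == 0) = (u == 0).
Proof.
apply/eqP/eqP => [|->]; last exact: dot0l.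
move=> u0; apply/rowP => i; rewrite mxE.
have /psumr_eq0P h : forall i, true -> 0 <= u ord0 i * u ord0 i.
  by move=> j _; rewrite -expr2 sqr_ge0.
by have /eqP := h u0 i isT; rewrite mulf_eq0 orbb => /eqP.
Qed.

Lemma dot_row_mx k m (y y' : 'rV[R]_k) (z z' : 'rV[R]_m) :
  dot (row_mx y z) (row_mx y' z') = dot y y' + dot z z'.
Proof.
rewrite /dot big_split_ord /=; congr (_ + _); apply: eq_bigr => i _.
  by rewrite !row_mxEl.
by rewrite !row_mxEr.
Qed.

Lemma euclid_norm_ge0 n (u : 'rV[R]_n) : 0 <= euclid_norm u.
Proof. exact: sqrtr_ge0. Qed.

Lemma sqr_euclid_norm n (u : 'rV[R]_n) : euclid_norm u ^+ 2 = dot u u.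
Proof. by rewrite sqr_sqrtr// dot_ge0. Qed.

Lemma euclid_norm_eq0 n (u : 'rV[R]_n) : (euclid_norm u == 0) = (u == 0).
Proof. by rewrite -(sqrf_eq0 (euclid_norm u)) sqr_euclid_norm dot_eq0. Qed.

Lemma euclid_norm0 n : euclid_norm (0 : 'rV[R]_n) = 0.
Proof. by apply/eqP; rewrite euclid_norm_eq0. Qed.

Lemma euclid_normZ n c (u : 'rV[R]_n) : euclid_norm (c *: u) = `|c| * euclid_norm u.
Proof. by rewrite /euclid_norm dotZl dotZr mulrA -expr2 sqrtrM ?sqr_ge0// sqrtr_sqr. Qed.

Lemma euclid_normN n (u : 'rV[R]_n) : euclid_norm (- u) = euclid_norm u.
Proof. by rewrite -scaleN1r euclid_normZ normrN1 mul1r. Qed.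

Lemma dot_le_norm n (u v : 'rV[R]_n) : dot u v <= euclid_norm u * euclid_norm v.
Proof.
have [->|u0] := eqVneq u 0; first by rewrite dot0l euclid_norm0 mul0r.
have [->|v0] := eqVneq v 0; first by rewrite dotC dot0l euclid_norm0 mulr0.
have nu : 0 < euclid_norm u by rewrite lt_neqAle eq_sym euclid_norm_eq0 u0 euclid_norm_ge0.
have nv : 0 < euclid_norm v by rewrite lt_neqAle eq_sym euclid_norm_eq0 v0 euclid_norm_ge0.
set a := euclid_norm u; set b := euclid_norm v.
(* The square of [|b u - a v|] equals [2 a b (a b - <u, v>)] when [a] and [b] are the norms of [u]
   and [v]. *)
have : 0 <= dot (b *: u - a *: v) (b *: u - a *: v) by exact: dot_ge0.
rewrite dotDl !dotDr !dotNl !dotNr !dotZl !dotZr (dotC v u) -!sqr_euclid_norm -/a -/b.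
have ab : 0 < a * b by rewrite mulr_gt0.
rewrite (_ : _ + _ = 2 * (a * b) * (a * b - dot u v)); last by ring.
by rewrite pmulr_rge0 ?subr_ge0// mulr_gt0.
Qed.

Lemma abs_dot_le_norm n (u v : 'rV[R]_n) : `|dot u v| <= euclid_norm u * euclid_norm v.
Proof.
rewrite ler_norml dot_le_norm andbT lerNl -dotNl -(euclid_normN u).
exact: dot_le_norm.
Qed.

Lemma euclid_normD n (u v : 'rV[R]_n) :
  euclid_norm (u + v) <= euclid_norm u + euclid_norm v.
Proof.
rewrite -ler_sqr ?nnegrE ?addr_ge0 ?euclid_norm_ge0// sqrrD !sqr_euclid_norm.
rewrite dotDl !dotDr (dotC v u) (_ : _ + _ = dot u u + dot u v *+ 2 + dot v v); last by ring.
by rewrite lerD2r lerD2l lerMn2r dot_le_norm orbT.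
Qed.

Lemma coord_le_euclid_norm n (u : 'rV[R]_n) i : `|u ord0 i| <= euclid_norm u.
Proof.
rewrite -sqrtr_sqr ler_sqrt ?dot_ge0// /dot (bigD1 i)//= expr2 lerDl.
by apply: sumr_ge0 => j _; rewrite -expr2 sqr_ge0.
Qed.

Lemma euclid_norm_le_sum n (u : 'rV[R]_n) : euclid_norm u <= \sum_i `|u ord0 i|.
Proof.
have s0 : 0 <= \sum_i `|u ord0 i| by apply: sumr_ge0.
rewrite -ler_sqr ?nnegrE ?euclid_norm_ge0// sqr_euclid_norm expr2 /dot mulr_suml.
apply: ler_sum => i _; rewrite (le_trans (ler_norm _))// normrM ler_wpM2l//.
by rewrite (bigD1 i)//= lerDl sumr_ge0.
Qed.

Lemma euclid_norm_row_mx k m (y : 'rV[R]_k) (z : 'rV[R]_m) :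
  euclid_norm (row_mx y z) ^+ 2 = euclid_norm y ^+ 2 + euclid_norm z ^+ 2.
Proof. by rewrite !sqr_euclid_norm dot_row_mx. Qed.

Lemma measurable_dot d n (T : measurableType d) (f g : T -> 'rV[R]_n) :
  measurable_fun setT f -> measurable_fun setT g ->
  measurable_fun setT (fun x => dot (f x) (g x)).
Proof.
move=> mf mg; apply: measurable_sum => i.
by apply: measurable_funM; apply: measurableT_comp (measurable_coord i) _.
Qed.

Lemma continuous_rV (T : topologicalType) n (f : T -> 'rV[R]_n) :
  (forall i, continuous (fun x => f x ord0 i : R)) -> continuous f.
Proof.
move=> cf x; apply/cvg_ballP => e e0.
have : \forall y \near x, forall i, ball (f x ord0 i : R) e (f y ord0 i : R).
  apply: filter_forall => i; have /cvg_ballP := cf i x; exact.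
apply: filterS => y h; split => // i j; rewrite !ord1; exact: h.
Qed.

Lemma continuous_coord n i : continuous (fun x : 'rV[R]_n => x ord0 i : R).
Proof. exact: coord_continuous. Qed.

Lemma continuous_fun_sum (T : topologicalType) (I : finType) (f : I -> T -> R) :
  (forall i, continuous (f i)) -> continuous (fun x => \sum_i f i x).
Proof.
by move=> cf; apply: continuous_big => [|i _]; [exact: add_continuous|exact: cf].
Qed.

Lemma continuous_dot (T : topologicalType) n (f g : T -> 'rV[R]_n) :
  continuous f -> continuous g -> continuous (fun x => dot (f x) (g x)).
Proof.
move=> cf cg; apply: continuous_fun_sum => i x; apply: cvgM.
  exact: (@continuous_comp _ _ _ f (fun v => v ord0 i : R) x (cf x) (@continuous_coord _ i _)).
exact: (@continuous_comp _ _ _ g (fun v => v ord0 i : R) x (cg x) (@continuous_coord _ i _)).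
Qed.

Lemma continuous_euclid_norm n : continuous (@euclid_norm R n).
Proof.
move=> x; apply: (@continuous_comp _ _ _ (fun x : 'rV[R]_n => dot x x) Num.sqrt).
  by apply: continuous_dot => y; exact: cvg_id.
exact: sqrt_continuous.
Qed.

Lemma continuous_mulmxr n k (U : 'M[R]_(n, k)) : continuous (fun x : 'rV[R]_n => x *m U).
Proof.
apply: continuous_rV => i; rewrite [X in continuous X](_ : _ =
    (fun x : 'rV[R]_n => \sum_j x ord0 j * U j i)); last first.
  by apply/funext => x; rewrite mxE.
apply: continuous_fun_sum => j x.
exact: (cvgM (@continuous_coord n j x) (cvg_cst (U j i))).
Qed.

End euclid.

(** * Borel sets, the unit ball, and invariance under orthogonal maps *)

Section borel_sets.
Context {R : realType}.
Implicit Types n k m : nat.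

Lemma measurable_open_box n (q : 'rV[R]_n) (e : R) :
  measurable [set v : 'rV[R]_n | forall i, `|v ord0 i - q ord0 i| < e].
Proof.
have -> : [set v : 'rV[R]_n | forall i, `|v ord0 i - q ord0 i| < e] =
    \bigcap_(i in [set: 'I_n]) ((fun x => x ord0 i) @^-1`
      `]q ord0 i - e, q ord0 i + e[%classic).
  apply/seteqP; split => v /= h i; last first.
    by have := h i Logic.I; rewrite /= in_itv/= -ltr_distl.
  by move=> _ /=; rewrite in_itv/= -ltr_distl.
apply: fin_bigcap_measurable => // i _.
rewrite -[X in measurable X]setTI; exact: measurable_coord.
Qed.

(** An open set is the union of those rational boxes that it contains, and there are countably
    many. *)
Lemma open_measurable_rV n (U : set 'rV[R]_n) : open U -> measurable U.
Proof.
move=> oU.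
pose box (p : 'rV[rat]_n * nat) : set 'rV[R]_n :=
  [set v | forall i, `|v ord0 i - (map_mx ratr p.1) ord0 i| < p.2.+1%:R^-1].
have -> : U = \bigcup_p (if `[< box p `<=` U >] then box p else set0).
  apply/seteqP; split => [x Ux|x [p _]]; last by case: asboolP => // bU /bU.
  have /nbhs_ballP[e /= e0 eU] : nbhs x U by exact: open_nbhs_nbhs.
  (* This makes the half-width of the box less than [e / 2]; a box that contains [x] then stays
     within distance [e] of it. *)
  pose k := Num.truncn (2 / e).
  have ke : 2 / e < k.+1%:R by rewrite truncnS_gt.
  have k0 : 0 < k.+1%:R^-1 :> R by rewrite invr_gt0.
  have kd : k.+1%:R^-1 < e / 2 by rewrite -[e / 2]invrK invf_div ltf_pV2// posrE ?divr_gt0.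
  have [d dE] : exists d, d = k.+1%:R^-1 :> R by eexists.
  rewrite -dE in k0 kd.
  have /fin_all_exists[q qP] (i : 'I_n) : exists q : rat, `|x ord0 i - ratr q| < d.
    have [q] := @rat_in_itvoo R (x ord0 i - d) (x ord0 i + d) ltac:(lra).
    by rewrite in_itv/= => qx; exists q; rewrite distrC ltr_distl.
  exists (\row_i q i, k) => //; rewrite asboolT.
    by move=> i; rewrite !mxE /= -dE.
  move=> v bv; apply: eU; split => // i j; rewrite !ord1.
  have := bv j; rewrite !mxE /= -dE => vq.
  rewrite -ball_normE /=; have := qP j.
  move: vq; rewrite !ltr_norml; lra.
apply: countable_bigcupT_measurable => [|p]; first exact: countableP.
by case: asboolP => // _; exact: measurable_open_box.
Qed.

Lemma closed_measurable_rV n (A : set 'rV[R]_n) : closed A -> measurable A.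
Proof. by move=> cA; rewrite -[A]setCK; apply: measurableC; apply: open_measurable_rV; exact: closed_openC. Qed.

Lemma compact_closed_rV n (A : set 'rV[R]_n) : compact A -> closed A.
Proof. by apply: compact_closed; exact: norm_hausdorff. Qed.

Lemma compact_measurable_rV n (A : set 'rV[R]_n) : compact A -> measurable A.
Proof. by move/compact_closed_rV/closed_measurable_rV. Qed.

Lemma compact_sub_cube n (A : set 'rV[R]_n) : compact A ->
  exists2 M, 0 <= M & A `<=` cube n (- M) M.
Proof.
move=> /compact_bounded[M [_ AM]]; exists (`|M| + 1); first by rewrite addr_ge0.
move=> x Ax i; rewrite -ler_norml; apply: le_trans (AM (`|M| + 1) _ x Ax).
  by rewrite [leRHS]/Num.norm/= mx_normrE; apply: (le_bigmax _ (fun ij => `|x ij.1 ij.2|) (ord0, i)).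
by rewrite ltr_pwDr// ler_norm.
Qed.

Lemma le_vol n (A B : set 'rV[R]_n) : measurable A -> measurable B -> A `<=` B ->
  (vol A <= vol B)%E.
Proof. by move=> mA mB AB; apply: (le_measure (@vol R n)); rewrite ?inE. Qed.

Lemma vol_compact_fin_num n (A : set 'rV[R]_n) : compact A -> vol A \is a fin_num.
Proof.
move=> cA; rewrite ge0_fin_numE ?vol_ge0//; have [M M0 AM] := compact_sub_cube cA.
apply: le_lt_trans (le_vol (compact_measurable_rV cA) (@measurable_cube R n _ _) AM) _.
by rewrite vol_cube ?ltry//; lra.
Qed.

Lemma compact_cube n (a b : R) : compact (cube n a b).
Proof.
rewrite (_ : cube n a b = [set v : 'rV[R]_n | forall i, `[a, b]%classic (v ord0 i)]).
  apply: (@rV_compact _ _ (fun=> `[a, b]%classic)) => _; exact: segment_compact.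
by apply/seteqP; split => v /= h i; have := h i; rewrite in_itv.
Qed.

Lemma compact_unit_ball n : compact (unit_ball R n).
Proof.
have cl : closed (unit_ball R n).
  rewrite (_ : unit_ball R n = @euclid_norm R n @^-1` [set r | r <= 1])//.
  apply: closed_comp; last exact: closed_le.
  by move=> x _; exact: continuous_euclid_norm.
apply: (subclosed_compact cl (@compact_cube n (-1) 1)) => x /= x1 i.
by rewrite -ler_norml (le_trans (coord_le_euclid_norm _ _)).
Qed.

Lemma measurable_unit_ball n : measurable (unit_ball R n).
Proof. by apply: compact_measurable_rV; exact: compact_unit_ball. Qed.

(* It keeps away from the coordinate hyperplanes, so that [`|g ord0 i|] is bounded below on it. *)
Definition inner_cube n := cube (R := R) n (n.+1%:R^-1 / 2) n.+1%:R^-1.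
Arguments inner_cube n : clear implicits.

Lemma inner_cube_sub n : inner_cube n `<=` unit_ball R n.
Proof.
move=> x h; apply: le_trans (euclid_norm_le_sum x) _.
apply: (@le_trans _ _ (\sum_(i < n) n.+1%:R^-1)).
  apply: ler_sum => i _; have /andP[h1 h2] := h i; rewrite ger0_norm//.
  by apply: le_trans h1; rewrite divr_ge0.
by rewrite sumr_const card_ord -[_ *+ n]mulr_natl ler_pdivrMr// mul1r ler_nat.
Qed.

Lemma vol_inner_cube_gt0 n : (0 < vol (inner_cube n))%E.
Proof.
have h : 0 < n.+1%:R^-1 :> R by rewrite invr_gt0.
rewrite /inner_cube; move: (n.+1%:R^-1) h => r h.
by rewrite vol_cube ?lte_fin ?exprn_gt0//; lra.
Qed.

Lemma vol_unit_ball_gt0 n : (0 < vol (unit_ball R n))%E.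
Proof.
apply: lt_le_trans (vol_inner_cube_gt0 n) _; apply: le_vol (@inner_cube_sub n).
  exact: measurable_cube.
exact: measurable_unit_ball.
Qed.

Lemma vol_unit_ballE n : vol (unit_ball R n) = (kappa n)%:E.
Proof. by rewrite fineK// vol_compact_fin_num//; exact: compact_unit_ball. Qed.

Lemma kappa_gt0 n : 0 < @kappa R n.
Proof. by rewrite -lte_fin -vol_unit_ballE vol_unit_ball_gt0. Qed.

Lemma dot_mulmx_orthogonal n (U : 'M[R]_n) (x y : 'rV[R]_n) :
  U *m U^T = 1%:M -> dot (x *m U) (y *m U) = dot x y.
Proof. by move=> UU; rewrite !dotE trmx_mul !mulmxA -(mulmxA x) UU mulmx1. Qed.

Lemma euclid_norm_orthogonal n (U : 'M[R]_n) (x : 'rV[R]_n) :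
  U *m U^T = 1%:M -> euclid_norm (x *m U) = euclid_norm x.
Proof. by move=> UU; rewrite /euclid_norm dot_mulmx_orthogonal. Qed.

(** The unit ball is its own preimage and has positive finite volume, so the proportionality factor
    is 1. *)
Lemma vol_orthogonal n (U : 'M[R]_n) (A : set 'rV[R]_n) :
  U *m U^T = 1%:M -> measurable A -> vol [set x | A (x *m U)] = vol A.
Proof.
move=> UU mA; have UU' := mulmx1C UU.
have := @vol_additive_preimage R n (fun x => x *m U) (fun x => x *m U^T) A (unit_ball R n)
  (@measurable_mulmxr _ _ _ U) (@measurable_mulmxr _ _ _ U^T).
have -> : [set x : 'rV[R]_n | unit_ball R n (x *m U)] = unit_ball R n.
  by apply/seteqP; split => x /=; rewrite /unit_ball/= euclid_norm_orthogonal.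
rewrite vol_unit_ballE [(vol [set x | A (x *m U)] * _)%E]muleC => h.
apply: (EFin_mulI (kappa_gt0 n)); apply: h => //; last exact: measurable_unit_ball.
- by move=> x; rewrite -mulmxA UU mulmx1.
- by move=> x; rewrite -mulmxA UU' mulmx1.
- by move=> x y; rewrite mulmxDl.
Qed.

End borel_sets.
Arguments inner_cube {R} n.

(** * Convex bodies, Minkowski sums, nearest points *)

Section convex_bodies.
Context {R : realType}.
Implicit Types n k m : nat.

Lemma convex_setP n (K : set 'rV[R]_n) :
  convex_set K <-> forall x y t, K x -> K y -> 0 <= t <= 1 -> K (t *: x + (1 - t) *: y).
Proof.
split=> [cK x y t Kx Ky /andP[t0 t1]|cK x y l].
  have := cK x y (Itv01 t0 t1); rewrite !inE; exact.
rewrite !inE => Kx Ky; apply: cK => //.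
by rewrite ge0 le1.
Qed.

Definition msum n (A B : set 'rV[R]_n) : set 'rV[R]_n := [set a + b | a in A & b in B].

Lemma convex_body_msum n (A B : set 'rV[R]_n) :
  convex_body A -> convex_body B -> convex_body (msum A B).
Proof.
move=> [[a Aa] cA /convex_setP vA] [[b Bb] cB /convex_setP vB]; split.
- by exists (a + b); exists a => //; exists b.
- have -> : msum A B = (fun p : 'rV[R]_n * 'rV[R]_n => p.1 + p.2) @` (A `*` B).
    apply/seteqP; split => x /= [].
      by move=> y Ay [z Bz <-]; exists (y, z).
    by move=> [y z] [/= Ay Bz] <-; exists y => //; exists z.
  apply: continuous_compact; last exact: compact_setX.
  by apply: continuous_subspaceT; exact: add_continuous.
apply/convex_setP => _ _ t [a1 A1 [b1 B1 <-]] [a2 A2 [b2 B2 <-]] t01.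
exists (t *: a1 + (1 - t) *: a2); first exact: vA.
exists (t *: b1 + (1 - t) *: b2); first exact: vB.
by rewrite !scalerDr addrACA.
Qed.

Lemma convex_body_mulmxr n k (U : 'M[R]_(n, k)) (A : set 'rV[R]_n) :
  convex_body A -> convex_body [set x *m U | x in A].
Proof.
move=> [[a Aa] cA /convex_setP vA]; split.
- by exists (a *m U); exists a.
- apply: continuous_compact => //.
  by apply: continuous_subspaceT; exact: continuous_mulmxr.
apply/convex_setP => _ _ t [a1 A1 <-] [a2 A2 <-] t01.
by exists (t *: a1 + (1 - t) *: a2); [exact: vA|rewrite mulmxDl -!scalemxAl].
Qed.

Lemma convex_body_dilate n c (A : set 'rV[R]_n) :
  convex_body A -> convex_body (dilate c A).
Proof.
move=> /(convex_body_mulmxr c%:M); congr convex_body.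
by apply/seteqP; split => _ [x Ax <-]; exists x; rewrite ?mul_mx_scalar.
Qed.

Lemma convex_body_unit_ball n : convex_body (unit_ball R n).
Proof.
split; [|exact: compact_unit_ball|].
  by exists 0; rewrite /unit_ball/= euclid_norm0.
apply/convex_setP => x y t; rewrite /unit_ball/= => x1 y1 /andP[t0 t1].
apply: le_trans (euclid_normD _ _) _; rewrite !euclid_normZ !ger0_norm ?subr_ge0//.
have := ler_wpM2l t0 x1; have := @ler_wpM2l _ (1 - t) _ _ _ y1; rewrite subr_ge0 => /(_ t1).
lra.
Qed.

Lemma parallel_bodyE n (K : set 'rV[R]_n) c :
  parallel_body K c = msum K (dilate c (unit_ball R n)).
Proof.
apply/seteqP; split => x /= [y Ky].
  by move=> [b Bb <-]; exists y => //; exists (c *: b) => //; exists b.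
by move=> [_ [b Bb <-] <-]; exists y => //; exists b.
Qed.

Lemma convex_body_parallel n (K : set 'rV[R]_n) c :
  convex_body K -> convex_body (parallel_body K c).
Proof.
move=> cK; rewrite parallel_bodyE; apply: convex_body_msum => //.
by apply: convex_body_dilate; exact: convex_body_unit_ball.
Qed.

Lemma convex_body_measurable n (K : set 'rV[R]_n) : convex_body K -> measurable K.
Proof. by case=> _ /compact_measurable_rV. Qed.

Lemma convex_body_fin_num n (K : set 'rV[R]_n) : convex_body K -> vol K \is a fin_num.
Proof. by case=> _ /vol_compact_fin_num. Qed.

Lemma parallel_bodyP n (K : set 'rV[R]_n) c x : 0 <= c ->
  parallel_body K c x <-> exists2 y, K y & euclid_norm (x - y) <= c.
Proof.
move=> c0; split => [[y Ky [b b1 <-]]|[y Ky yc]]; exists y => //.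
  by rewrite addrAC subrr add0r euclid_normZ ger0_norm// ler_piMr.
have [c0'|c0'] := eqVneq c 0.
  exists 0; first by rewrite /unit_ball/= euclid_norm0.
  rewrite scaler0 addr0; apply/esym/eqP.
  by rewrite -subr_eq0 -euclid_norm_eq0 eq_le euclid_norm_ge0 andbT -c0'.
have cp : 0 < c by rewrite lt_neqAle eq_sym c0'.
exists (c^-1 *: (x - y)).
  by rewrite /unit_ball/= euclid_normZ ger0_norm ?invr_ge0// mulrC ler_pdivrMr ?mul1r.
by rewrite scalerA divff// scale1r addrC subrK.
Qed.

Lemma nearest_point n (K : set 'rV[R]_n) x : K !=set0 -> compact K ->
  exists2 y, K y & forall z, K z -> euclid_norm (x - y) <= euclid_norm (x - z).
Proof.
move=> K0 cK.
have cd : continuous (fun y : 'rV[R]_n => euclid_norm (x - y)).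
  have cB : continuous (fun y : 'rV[R]_n => x - y).
    apply: continuous_rV => i.
    rewrite (_ : (fun y : 'rV[R]_n => _) = (fun y => x ord0 i - y ord0 i)).
      by move=> y; exact: (cvgB (cvg_cst (x ord0 i)) (@continuous_coord R n i y)).
    by apply/funext => y; rewrite !mxE.
  move=> y; exact: (@continuous_comp _ _ _ _ (@euclid_norm R n) y (cB y) (@continuous_euclid_norm _ _ _)).
have [y Ky yP] := compact_EVT_min K0 cK (continuous_subspaceT cd).
exists y; first by rewrite -inE.
by move=> z Kz; apply: yP; rewrite inE.
Qed.

End convex_bodies.

(** * Zonotopes *)

Section segments.
Context {R : realType}.
Implicit Types n k m : nat.
Notation leb := (@lebesgue_measure R).
Notation mR := (measurableTypeR R).

(* The Householder reflection exchanging [x] and [y]. *)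
Lemma exists_orthogonal_map n (x y : 'rV[R]_n) : dot x x = dot y y ->
  exists2 U : 'M[R]_n, U *m U^T = 1%:M & x *m U = y.
Proof.
move=> xy; have [->|neq] := eqVneq x y; first by exists 1%:M; rewrite ?trmx1 mulmx1.
set a := x - y; have a0 : dot a a != 0 by rewrite dot_eq0 subr_eq0.
have aaT : a *m a^T = (dot a a)%:M by rewrite [LHS]mx11_scalar -dotE.
pose U : 'M[R]_n := 1%:M - (2 / dot a a) *: (a^T *m a).
have xU z : z *m U = z - (2 * dot z a / dot a a) *: a.
  rewrite mulmxBr mulmx1 -scalemxAr mulmxA [z *m a^T]mx11_scalar -dotE.
  by rewrite mul_scalar_mx scalerA; congr (_ - _ *: _); ring.
exists U; last first.
  (* Equal norms give [2 <x, a> = <a, a>], so the reflection subtracts exactly [a = x - y] from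
     [x]. *)
  rewrite xU (_ : _ / _ = 1) ?scale1r ?subKr//.
  apply: (canLR (mulfK a0)); rewrite mul1r /a !dotDr !dotDl !dotNr !dotNl (dotC y x) -xy.
  ring.
have -> : U^T = U.
  by rewrite /U linearB /= trmx1 linearZ /= trmx_mul trmxK.
(* As [U] is symmetric, the claim is that reflecting a row twice restores it. *)
apply/row_matrixP => i; rewrite -[U *m U]mul1mx !row_mul mulmxA.
have dz z c w : dot (z - c *: w) a = dot z a - c * dot w a by rewrite dotDl dotNl dotZl.
move: (row i _) => z; rewrite xU xU dz divfK// -addrA -opprD -scalerDl.
rewrite [X in X *: _](_ : _ = 0) ?scale0r ?subr0 ?mulmx1//.
by rewrite -mulrDl [X in X / _](_ : _ = 0) ?mul0r//; ring.
Qed.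

Lemma mulmxr_imageE n (U : 'M[R]_n) (A : set 'rV[R]_n) : U *m U^T = 1%:M ->
  [set x *m U | x in A] = [set x | A (x *m U^T)].
Proof.
move=> UU; apply/seteqP; split => [_ [x Ax <-]|x Ax] /=.
  by rewrite -mulmxA UU mulmx1.
by exists (x *m U^T) => //; rewrite -mulmxA (mulmx1C UU) mulmx1.
Qed.

Lemma vol_mulmxr n (U : 'M[R]_n) (A : set 'rV[R]_n) : U *m U^T = 1%:M ->
  measurable A -> vol [set x *m U | x in A] = vol A.
Proof.
move=> UU mA; rewrite mulmxr_imageE// vol_orthogonal// trmxK.
exact: mulmx1C.
Qed.

Lemma msum_mulmxr n k (U : 'M[R]_(n, k)) (A B : set 'rV[R]_n) :
  [set x *m U | x in msum A B] = msum [set x *m U | x in A] [set x *m U | x in B].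
Proof.
apply/seteqP; split => [_ [_ [a Aa [b Bb <-]] <-]|_ [_ [a Aa <-] [_ [b Bb <-] <-]]].
  by exists (a *m U); [exists a|exists (b *m U); [exists b|rewrite mulmxDl]].
by exists (a + b); [exists a => //; exists b|rewrite mulmxDl].
Qed.

Lemma dilate_mulmxr n k c (U : 'M[R]_(n, k)) (A : set 'rV[R]_n) :
  [set x *m U | x in dilate c A] = dilate c [set x *m U | x in A].
Proof.
apply/seteqP; split => [_ [_ [a Aa <-] <-]|_ [_ [a Aa <-] <-]].
  by exists (a *m U); [exists a|rewrite scalemxAl].
by exists (c *: a); [exists a|rewrite scalemxAl].
Qed.

Lemma measurable_fun_leb_sections n (A : set 'rV[R]_n.+1) : measurable A ->
  measurable_fun setT (fun v : 'rV[R]_n => leb [set t | A (row_cons (t, v))]).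
Proof.
move=> mA; rewrite (_ : (fun v => _) = leb \o ysection (@row_cons R n @^-1` A)).
  by apply: measurable_fun_ysection; apply: measurable_preimage mA; exact: measurable_row_cons.
by apply/funext => v /=; rewrite ysectionE.
Qed.

Lemma volS_swap n (A : set 'rV[R]_n.+1) : measurable A ->
  (vol A = \int[vol (n := n)]_v leb [set t | A (row_cons (t, v))])%E.
Proof.
move=> mA; rewrite -(vol_sections leb (@vol R n) (D := [set p | A (row_cons p)]))//.
by apply: measurable_preimage mA; exact: measurable_row_cons.
Qed.

Definition segment n (u : 'rV[R]_n) : set 'rV[R]_n :=
  [set s *: u | s in `[-1, 1]%classic].

Lemma segment_mulmxr n k (U : 'M[R]_(n, k)) (u : 'rV[R]_n) :
  [set x *m U | x in segment u] = segment (u *m U).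
Proof.
apply/seteqP; split => [_ [_ [s s1 <-] <-]|_ [s s1 <-]].
  by exists s; rewrite // scalemxAl.
by exists (s *: u); [exists s|rewrite scalemxAl].
Qed.

Lemma convex_body_segment n (u : 'rV[R]_n) : convex_body (segment u).
Proof.
have -> : segment u = [set x *m u | x in unit_ball R 1].
  apply/seteqP; split => [_ [s s1 <-]|_ [x x1 <-]].
    exists s%:M; last by rewrite mul_scalar_mx.
    rewrite /unit_ball/= /euclid_norm dotE tr_scalar_mx -scalar_mxM mxE eqxx mulr1n.
    by rewrite -expr2 sqrtr_sqr ler_norml; move: s1; rewrite /= in_itv.
  exists (x ord0 ord0); last by rewrite [in RHS](mx11_scalar x) mul_scalar_mx.
  by rewrite /= in_itv/= -ler_norml (le_trans (coord_le_euclid_norm _ _)).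
exact/convex_body_mulmxr/convex_body_unit_ball.
Qed.

Definition tail n (x : 'rV[R]_n.+1) : 'rV[R]_n := \row_i x ord0 (lift ord0 i).

Lemma tail_row_cons n p : @tail n (row_cons p) = p.2.
Proof. by apply/rowP => i; rewrite mxE row_consS. Qed.

Lemma row_cons_tail n (x : 'rV[R]_n.+1) : row_cons (x ord0 ord0, tail x) = x.
Proof. by rewrite [RHS]row_consE. Qed.

Lemma continuous_tail n : continuous (@tail n).
Proof.
apply: continuous_rV => i; rewrite (_ : (fun x => _) = (fun x : 'rV[R]_n.+1 => x ord0 (lift ord0 i))).
  exact: continuous_coord.
by apply/funext => x; rewrite mxE.
Qed.

(** The points of [K] with [tail x = v] form a compact set, on which the first coordinate attains a
    minimum and a maximum; convexity fills in the values between. *)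
Lemma convex_slice n (K : set 'rV[R]_n.+1) (v : 'rV[R]_n) : convex_body K ->
  (exists t, K (row_cons (t, v))) ->
  exists2 p : R * R, p.1 <= p.2 & [set t | K (row_cons (t, v))] = `[p.1, p.2]%classic.
Proof.
move=> [_ cK /convex_setP vK] [t Kt].
pose Kv := K `&` [set x | tail x = v].
have cKv : compact Kv.
  apply: compact_closedI => //.
  rewrite (_ : [set x | _] = (fun x => euclid_norm (tail x - v)) @^-1` [set 0]); last first.
    apply/seteqP; split => x /=; first by move=> ->; rewrite subrr euclid_norm0.
    by move/eqP; rewrite euclid_norm_eq0 subr_eq0 => /eqP.
  apply: closed_comp; last exact: closed_eq.
  move=> x _.
  have cB : continuous (fun x : 'rV[R]_n.+1 => tail x - v).
    apply: continuous_rV => i.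
    rewrite (_ : (fun y => _) = (fun y : 'rV[R]_n.+1 => y ord0 (lift ord0 i) - v ord0 i)).
      by move=> y; exact: (cvgB (@continuous_coord R _ _ y) (cvg_cst (v ord0 i))).
    by apply/funext => y; rewrite !mxE.
  exact: (@continuous_comp _ _ _ _ (@euclid_norm R n) x (cB x) (@continuous_euclid_norm _ _ _)).
have Kv0 : Kv !=set0 by exists (row_cons (t, v)); split => //=; rewrite tail_row_cons.
have cc : {within Kv, continuous (fun x : 'rV[R]_n.+1 => x ord0 ord0 : R)}.
  by apply: continuous_subspaceT; exact: continuous_coord.
have [a + aP] := compact_EVT_min Kv0 cKv cc; rewrite inE => -[Ka av].
have [b + bP] := compact_EVT_max Kv0 cKv cc; rewrite inE => -[Kb bv].
have inKv s : K (row_cons (s, v)) -> row_cons (s, v) \in Kv.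
  by move=> Ks; rewrite inE; split => //=; rewrite tail_row_cons.
exists (a ord0 ord0, b ord0 ord0) => /=.
  by apply: aP; rewrite inE.
apply/seteqP; split => s /= => [Ks|].
  have := aP _ (inKv _ Ks); have := bP _ (inKv _ Ks); rewrite !row_cons0 /= in_itv/=.
  by move=> -> ->.
rewrite in_itv/= => /andP[sa sb].
move: Ka Kb sa sb; rewrite -(row_cons_tail a) -(row_cons_tail b) av bv !row_cons0.
move: (a ord0 ord0) (b ord0 ord0) => {a av aP b bv bP} a b /= Ka Kb sa sb.
have [ab|ab] := eqVneq a b; first by rewrite (_ : s = a)//; lra.
have ba : 0 < b - a by rewrite subr_gt0 lt_neqAle ab (le_trans sa).
have := vK _ _ ((b - s) / (b - a)) Ka Kb.
rewrite divr_ge0 ?ler_pdivrMr ?mul1r; [|lra..].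
have h1 : 1 - (b - s) / (b - a) = (s - a) / (b - a).
  by apply: (mulIf (lt0r_neq0 ba)); rewrite mulrBl !divfK ?(lt0r_neq0 ba)//; ring.
have -> : (b - s) / (b - a) *: row_cons (a, v) + (1 - (b - s) / (b - a)) *: row_cons (b, v) =
    row_cons (s, v).
  apply/rowP => i; rewrite mxE [X in X + _]mxE [X in _ + X]mxE.
  have [j ->|->] := unliftP ord0 i; first by rewrite !row_consS /=; ring.
  by rewrite !row_cons0 /= h1; field; exact: lt0r_neq0.
apply; lra.
Qed.

End segments.

(** * Volume of the sum of a convex body and a zonotope *)

Section zonotopes.
Context {R : realType}.
Implicit Types n k m : nat.
Notation leb := (@lebesgue_measure R).
Notation mR := (measurableTypeR R).

Lemma lebesgue_measure_segment (a b : R) : a <= b -> leb `[a, b]%classic = (b - a)%:E.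
Proof.
move=> ab; have := lebesgue_measure_itv `[a, b]; rewrite /= lte_fin => ->.
by case: ltgtP ab => // -> _; rewrite subrr.
Qed.

Definition axis n : 'rV[R]_n.+1 := row_cons (1, 0).

Lemma msum_axis n (K : set 'rV[R]_n.+1) r t v : 0 <= r ->
  msum K (dilate r (segment (axis n))) (row_cons (t, v)) <->
  exists2 s, -r <= s <= r & K (row_cons (t - s, v)).
Proof.
move=> r0; have rowB s x w : row_cons (x - s, w) + s *: axis n = row_cons (x, w).
  apply/rowP => i; rewrite mxE [X in _ + X]mxE; have [j ->|->] := unliftP ord0 i; rewrite /axis.
    by rewrite !row_consS /= mxE mulr0 addr0.
  by rewrite !row_cons0 /= mulr1 subrK.
split=> [[x Kx [_ [_ [s + <-] <-] xE]]|[s s1 Ks]].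
  rewrite /= in_itv/= => s1; exists (r * s).
    case/andP: s1 => s1 s2; have := ler_wpM2l r0 s1; have := ler_wpM2l r0 s2; lra.
  rewrite (_ : row_cons _ = x)//; apply: (addIr ((r * s) *: axis n)).
  by rewrite rowB -xE scalerA.
exists (row_cons (t - s, v)) => //; exists (s *: axis n); last exact: rowB.
have [r00|rn0] := eqVneq r 0.
  exists 0; first by exists 0; rewrite ?scale0r//= in_itv/=; lra.
  by rewrite scaler0 (_ : s = 0) ?scale0r//; lra.
have rp : 0 < r by rewrite lt_neqAle eq_sym rn0.
exists ((s / r) *: axis n); last by rewrite scalerA mulrC divfK.
by exists (s / r) => //; rewrite /= in_itv/= ler_pdivrMr// ler_pdivlMr// mul1r mulN1r.
Qed.

(** Each line parallel to the axis that meets [K] meets it in a segment, which grows by [r] at both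
    ends; the other lines still miss the sum. *)
Lemma vol_msum_axis n (K : set 'rV[R]_n.+1) r : 0 <= r -> convex_body K ->
  (vol (msum K (dilate r (segment (axis n)))) =
   vol K + (2 * r)%:E * vol (@tail R n @` K))%E.
Proof.
move=> r0 bK; have [K0 cK _] := bK.
have cT : compact (@tail R n @` K).
  by apply: continuous_compact => //; apply: continuous_subspaceT; exact: continuous_tail.
have mT := compact_measurable_rV cT.
have mK := convex_body_measurable bK.
have mM : measurable (msum K (dilate r (segment (axis n)))).
  by apply: convex_body_measurable; apply/convex_body_msum/convex_body_dilate/convex_body_segment.
rewrite !volS_swap// -[vol (_ @` _)]mul1e.
have -> : (1 * vol (@tail R n @` K) = \int[@vol R n]_v (\1_(@tail R n @` K) v)%:E)%E.
  by rewrite integral_indic// setIT mul1e.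
rewrite -ge0_integralZl//; last 2 first.
- exact/measurable_EFinP.
- by rewrite lee_fin mulr_ge0.
have mleb := measurable_fun_leb_sections mK.
have mind : measurable_fun setT (fun v => (2 * r)%:E * (\1_(@tail R n @` K) v)%:E)%E.
  by apply: measurable_funeM; exact/measurable_EFinP.
rewrite -ge0_integralD//; last by move=> v _; rewrite mule_ge0// lee_fin mulr_ge0.
apply: eq_integral => v _; rewrite indicE.
have [/set_mem[x Kx xv]|/negP nv] := boolP (v \in _); last first.
  rewrite mule0 adde0; congr leb; apply/seteqP; split => t /=.
    move=> /(msum_axis _ _ _ r0)[s _ Ks]; exfalso; apply: nv; rewrite inE.
    by exists (row_cons (t - s, v)); rewrite ?tail_row_cons.
  move=> Kt; exfalso; apply: nv; rewrite inE.
  by exists (row_cons (t, v)); rewrite ?tail_row_cons.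
have [[a b] /= ab KE] : exists2 p : R * R, p.1 <= p.2 &
    [set t | K (row_cons (t, v))] = `[p.1, p.2]%classic.
  by apply: convex_slice => //; exists (x ord0 ord0); rewrite -xv row_cons_tail.
rewrite KE [X in leb X = _](_ : _ = `[a - r, b + r]%classic); last first.
  apply/seteqP; split => t.
    move=> /(msum_axis _ _ _ r0)[s sr Ks].
    have : [set t | K (row_cons (t, v))] (t - s) by [].
    by rewrite KE /= !in_itv/=; lra.
  rewrite /= in_itv/= => tab; apply/(msum_axis _ _ _ r0).
  (* The smallest displacement that brings [t] back into [[a, b]]. *)
  pose s := if t < a then t - a else if b < t then t - b else 0.
  exists s; first by rewrite /s; case: ifPn => ?; [lra|case: ifPn => ?; lra].
  have : `[a, b]%classic (t - s).
    by rewrite /= in_itv/= /s; case: ltP => ?; [lra|case: ltP => ?; lra].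
  by rewrite -KE.
rewrite !lebesgue_measure_segment//; last by lra.
by rewrite mule1 -EFinD; congr EFin; ring.
Qed.

Lemma msum0 n (K : set 'rV[R]_n) : msum K [set 0] = K.
Proof.
apply/seteqP; split => [_ [x Kx [_ -> <-]]|x Kx]; first by rewrite addr0.
by exists x => //; exists 0; rewrite ?addr0.
Qed.

Lemma msumA n (A B C : set 'rV[R]_n) : msum A (msum B C) = msum (msum A B) C.
Proof.
apply/seteqP; split => [_ [a Aa [_ [b Bb [c Cc <-]] <-]]|_ [_ [a Aa [b Bb <-]] [c Cc <-]]].
  by exists (a + b); [exists a => //; exists b|exists c => //; rewrite addrA].
by exists a => //; exists (b + c); [exists b => //; exists c|rewrite addrA].
Qed.

Lemma dilate_msum n c (A B : set 'rV[R]_n) :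
  dilate c (msum A B) = msum (dilate c A) (dilate c B).
Proof.
apply/seteqP; split => [_ [_ [a Aa [b Bb <-]] <-]|_ [_ [a Aa <-] [_ [b Bb <-] <-]]].
  by exists (c *: a); [exists a|exists (c *: b); [exists b|rewrite scalerDr]].
by exists (a + b); [exists a => //; exists b|rewrite scalerDr].
Qed.

Lemma msumC n (A B : set 'rV[R]_n) : msum A B = msum B A.
Proof.
by apply/seteqP; split => _ [a Aa [b Bb <-]]; exists b => //; exists a; rewrite // addrC.
Qed.

(* Along [u] the body is a union of segments, each lengthened by the same amount. *)
Lemma vol_msum_segment n (K : set 'rV[R]_n) (u : 'rV[R]_n) : convex_body K ->
  exists b : R, forall r, 0 <= r ->
    (vol (msum K (dilate r (segment u))) = vol K + (r * b)%:E)%E.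
Proof.
move=> bK; have [->|u0] := eqVneq u 0.
  exists 0 => r r0; rewrite mulr0 adde0 (_ : dilate r _ = [set 0]) ?msum0//.
  apply/seteqP; split => [_ [_ [s _ <-] <-]|_ ->] /=; first by rewrite !scaler0.
  by exists 0; rewrite ?scaler0//; exists 0; rewrite ?scaler0//= in_itv/=; lra.
case: n K u bK u0 => [|n] K u bK u0; first by rewrite thinmx0 eqxx in u0.
have [U UU uU] : exists2 U : 'M[R]_n.+1, U *m U^T = 1%:M &
    u *m U = euclid_norm u *: axis n.
  apply: exists_orthogonal_map; rewrite dotZl dotZr mulrA -expr2 sqr_euclid_norm.
  rewrite /axis [dot (row_cons _) _]big_ord_recl row_cons0 big1 ?mulr1 ?addr0 ?mulr1// => i _.
  by rewrite !row_consS mxE mul0r.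
pose KU := [set x *m U | x in K].
have bKU : convex_body KU by exact: convex_body_mulmxr.
have cT : compact (@tail R n @` KU).
  have [_ cK _] := bKU.
  by apply: continuous_compact => //; apply: continuous_subspaceT; exact: continuous_tail.
(* After rotation [u] is [euclid_norm u] times the axis, so the slope is twice its length times the
   volume of the shadow of the rotated body. *)
exists (2 * euclid_norm u * fine (vol (@tail R n @` KU))) => r r0.
have mM : measurable (msum K (dilate r (segment u))).
  by apply: convex_body_measurable; apply/convex_body_msum/convex_body_dilate/convex_body_segment.
rewrite -(vol_mulmxr UU mM) msum_mulmxr dilate_mulmxr segment_mulmxr uU.
have -> : dilate r (segment (euclid_norm u *: axis n)) =
    dilate (r * euclid_norm u) (segment (axis n)).
  by apply/seteqP; split => _ [_ [s s1 <-] <-]; rewrite scalerA;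
    [exists (s *: axis n); [exists s|]|exists (s *: (euclid_norm u *: axis n)); [exists s|]];
    rewrite // !scalerA; congr (_ *: _); ring.
rewrite vol_msum_axis ?mulr_ge0 ?euclid_norm_ge0// -/KU.
rewrite (vol_mulmxr UU (convex_body_measurable bK)); congr (_ + _)%E.
rewrite -[vol (_ @` _)]fineK ?vol_compact_fin_num// -EFinM; congr EFin.
by rewrite fineK ?vol_compact_fin_num//; ring.
Qed.

Definition zonotope n (us : seq 'rV[R]_n) : set 'rV[R]_n :=
  foldr (fun u Z => msum (segment u) Z) [set 0] us.

Lemma convex_body_zonotope n (us : seq 'rV[R]_n) : convex_body (zonotope us).
Proof.
elim: us => [|u us IH] /=; last by apply: convex_body_msum => //; exact: convex_body_segment.
split; first by exists 0.
  exact: compact_set1.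
by apply/convex_setP => _ _ t -> -> _; rewrite !scaler0 addr0.
Qed.

(** Let [p] and [q] be the polynomials of [K] and of [K + S] for the remaining generators, with
    zonotope [Z], where [S] is the first segment. The volume of [K + c Z + r S] is affine in [r];
    its values at [r = 0] and [r = 1] are [p(c)] and [q(c)], so at [r = c] it is
    [p(c) + c (q(c) - p(c))]. *)
Lemma vol_msum_zonotope n (us : seq 'rV[R]_n) (K : set 'rV[R]_n) : convex_body K ->
  exists p : {poly R}, forall c, 0 <= c ->
    (vol (msum K (dilate c (zonotope us))) = p.[c]%:E)%E.
Proof.
elim: us K => [|u us IH] K bK.
  exists (fine (vol K))%:P => c c0; rewrite hornerC fineK ?convex_body_fin_num//.
  rewrite (_ : dilate c _ = [set 0]) ?msum0//.
  by apply/seteqP; split => [_ [_ -> <-]|_ ->] /=; [rewrite scaler0|exists 0; rewrite ?scaler0].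
have [p pP] := IH K bK.
have [q qP] := IH _ (convex_body_msum bK (convex_body_segment u)).
exists (p + 'X * (q - p)) => c c0.
have swap (s : R) : msum (msum K (dilate s (segment u))) (dilate c (zonotope us)) =
    msum (msum K (dilate c (zonotope us))) (dilate s (segment u)).
  by rewrite -!msumA [in RHS](msumC (dilate c _)).
have [b bP] := vol_msum_segment u (convex_body_msum bK (convex_body_dilate c (convex_body_zonotope us))).
have dil1 : dilate 1 (segment u) = segment u.
  by apply/seteqP; split => [_ [x Ax <-]|x Ax]; [rewrite scale1r|exists x; rewrite ?scale1r].
rewrite /= dilate_msum msumA swap bP// pP//.
have := bP 1 ler01; rewrite -swap dil1 qP// pP// mul1r -!EFinD => -[qpb].
by congr EFin; rewrite !hornerE qpb; ring.
Qed.

End zonotopes.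

(** * Mean width and support functions of zonotopes *)

Section ball_zonoid.
Context {R : realType}.
Implicit Types n k m : nat.

(* The support function of a zonoid, a limit of zonotopes; by rotation invariance
   it is a multiple of the euclidean norm. *)
Definition mean_width n (x : 'rV[R]_n) : \bar R :=
  (\int[vol (n := n)]_(g in unit_ball R n) `|dot x g|%:E)%E.

Lemma measurable_abs_dot n (x : 'rV[R]_n) :
  measurable_fun setT (fun g => `|dot x g|%:E)%E.
Proof.
apply/measurable_EFinP; apply: measurableT_comp => //.
by apply: measurable_dot; [exact: measurable_cst|exact: measurable_id].
Qed.

Lemma mean_widthZ n c (x : 'rV[R]_n) : mean_width (c *: x) = (`|c|%:E * mean_width x)%E.
Proof.
rewrite /mean_width -ge0_integralZl//; last 2 first.
- exact: measurable_unit_ball.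
- by apply: measurable_funTS; exact: measurable_abs_dot.
by apply: eq_integral => g _; rewrite dotZl normrM.
Qed.

Lemma mean_width_orthogonal n (U : 'M[R]_n) (x : 'rV[R]_n) : U *m U^T = 1%:M ->
  mean_width (x *m U) = mean_width x.
Proof.
move=> UU; have UU' : U^T *m U^T^T = 1%:M by rewrite trmxK; exact: mulmx1C.
rewrite /mean_width.
(* The substitution of [g *m U^T] for [g] moves [U] from [x] to the other side of the inner product;
   ball and volume are unchanged. *)
transitivity (\int[vol (n := n)]_(g in (fun g => g *m U^T) @^-1` unit_ball R n)
    ((fun g => `|dot x g|%:E) \o (fun g => g *m U^T)) g)%E.
  have -> : (fun g => g *m U^T) @^-1` unit_ball R n = unit_ball R n.
    by apply/seteqP; split => g /=; rewrite /unit_ball/= euclid_norm_orthogonal.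
  apply: eq_integral => g _ /=; congr (`| _ |%:E).
  by rewrite -(dot_mulmx_orthogonal _ (g *m U^T) UU) -mulmxA -[X in _ *m (_ *m X)]trmxK UU' mulmx1.
rewrite -(ge0_integral_pushforward (@measurable_mulmxr R n n U^T))//; last 2 first.
- exact: measurable_unit_ball.
- by apply: measurable_funTS; exact: measurable_abs_dot.
apply: (eq_measure_integral (@vol R n)); first exact: measurable_mulmxr.
by move=> mU A mA _; exact: (vol_orthogonal UU' mA).
Qed.

Lemma mean_width_fin_num n (x : 'rV[R]_n) : mean_width x \is a fin_num.
Proof.
rewrite ge0_fin_numE; last by apply: integral_ge0 => g _; rewrite lee_fin.
apply: (@le_lt_trans _ _ (\int[vol (n := n)]_(g in unit_ball R n) (euclid_norm x)%:E)%E).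
  apply: ge0_le_integral => //.
  - exact: measurable_unit_ball.
  - by apply: measurable_funTS; exact: measurable_abs_dot.
  - move=> g g1; rewrite lee_fin (le_trans (abs_dot_le_norm _ _))//.
    by rewrite ler_piMr// euclid_norm_ge0.
rewrite integral_cst; last exact: measurable_unit_ball.
by rewrite /= vol_unit_ballE -EFinM ltry.
Qed.

(** On [inner_cube] the first coordinate of [g] is bounded below, and that cube has positive
    volume. *)
Lemma mean_width_axis_gt0 n : (0 < mean_width (axis n : 'rV[R]_n.+1))%E.
Proof.
have r0 : 0 < n.+2%:R^-1 / 2 :> R by rewrite divr_gt0.
apply: (@lt_le_trans _ _ ((n.+2%:R^-1 / 2)%:E * vol (inner_cube (R := R) n.+1))%E).
  by rewrite mule_gt0// vol_inner_cube_gt0.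
rewrite -integral_cst; last exact: measurable_cube.
apply: (@le_trans _ _ (\int[vol (n := n.+1)]_(g in inner_cube n.+1) `|dot (axis n) g|%:E)%E).
  apply: ge0_le_integral => //.
  - exact: measurable_cube.
  - by move=> g _; rewrite lee_fin ltW.
  - by apply: measurable_funTS; exact: measurable_abs_dot.
  - move=> g gc; rewrite lee_fin /dot big_ord_recl big1 ?addr0 => [|i _]; last first.
      by rewrite /axis row_consS mxE mul0r.
    rewrite /axis row_cons0 mul1r; have /andP[h _] := gc ord0.
    exact: le_trans h (ler_norm _).
apply: ge0_subset_integral => //.
- exact: measurable_cube.
- exact: measurable_unit_ball.
- by apply: measurable_funTS; exact: measurable_abs_dot.
- exact: inner_cube_sub.
Qed.

Lemma mean_width_proportional n :
  exists2 a : R, 0 < a & forall x : 'rV[R]_n, mean_width x = (a * euclid_norm x)%:E.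
Proof.
case: n => [|n].
  (* In dimension 0 both sides vanish, and any positive constant would do. *)
  exists 1 => // x; rewrite (thinmx0 x) euclid_norm0 mulr0.
  by rewrite /mean_width integral0_eq// => g _; rewrite dot0l normr0.
have gt0 := mean_width_axis_gt0 n; have fin := mean_width_fin_num (axis n : 'rV[R]_n.+1).
exists (fine (mean_width (axis n : 'rV[R]_n.+1))).
  by rewrite fine_gt0// gt0 -ge0_fin_numE// ltW.
move=> x; have [|U UU <-] := @exists_orthogonal_map R _ (euclid_norm x *: axis n) x.
  rewrite dotZl dotZr mulrA -expr2 sqr_euclid_norm.
  rewrite /axis [dot (row_cons _) _]big_ord_recl row_cons0 big1 ?mulr1 ?addr0 ?mulr1// => i _.
  by rewrite !row_consS mxE mul0r.
rewrite mean_width_orthogonal// mean_widthZ ger0_norm ?euclid_norm_ge0//.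
rewrite -{1}(fineK fin) -EFinM mulrC; congr (_ * _)%:E.
rewrite euclid_norm_orthogonal// euclid_normZ ger0_norm ?euclid_norm_ge0//.
rewrite [euclid_norm (axis n)](_ : _ = 1) ?mulr1//.
rewrite /euclid_norm /axis /dot big_ord_recl row_cons0 big1 ?mulr1 ?addr0 ?sqrtr1// => i _.
by rewrite !row_consS mxE mul0r.
Qed.

(** A segment contributes [s <v, u>] with [|s| <= 1], at most [|<v, u>|]. With the next lemma this
    identifies the support function of a zonotope. *)
Lemma zonotope_support_le n (us : seq 'rV[R]_n) v z : zonotope us z ->
  dot v z <= \sum_(u <- us) `|dot v u|.
Proof.
elim: us z => [|u us IH] z /=; first by move=> ->; rewrite dotC dot0l big_nil.
move=> [_ [s + <-] [z' /IH h <-]]; rewrite /= in_itv/= -ler_norml => s1.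
rewrite dotDr dotZr big_cons lerD// (le_trans (ler_norm _))// normrM.
by rewrite ler_piMl.
Qed.

Lemma zonotope_support_attained n (us : seq 'rV[R]_n) v :
  exists2 z, zonotope us z & dot v z = \sum_(u <- us) `|dot v u|.
Proof.
elim: us => [|u us [z Zz zE]] /=; first by exists 0; rewrite // dotC dot0l big_nil.
(* The end of the segment on the side of [v], chosen by the sign of the inner product. *)
exists (Num.sg (dot v u) *: u + z).
  exists (Num.sg (dot v u) *: u); last by exists z.
  exists (Num.sg (dot v u)) => //; rewrite /= in_itv/= -ler_norml normr_sg.
  by case: eqP.
by rewrite dotDr dotZr big_cons zE normrEsg.
Qed.

Lemma dot_subZ n (v w : 'rV[R]_n) t :
  dot (v - t *: w) (v - t *: w) = dot v v - t * (2 * dot v w - t * dot w w).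
Proof. by rewrite dotDl !dotDr !dotNl !dotNr !dotZl !dotZr (dotC w v); ring. Qed.

(** Separation by the nearest point [y]: if [v = x - y] were nonzero, then [<v, z> <= <v, y> < <v,
    x> <= |v| |x| < r |v|] for every [z] in [Z], against the lower bound on the support function. *)
Lemma convex_body_ball_sub n (Z : set 'rV[R]_n) (r : R) : convex_body Z ->
  (forall v, exists2 z, Z z & r * euclid_norm v <= dot v z) ->
  forall x, euclid_norm x < r -> Z x.
Proof.
move=> [Z0 cZ /convex_setP vZ] supp x xr.
have [y Zy yP] := nearest_point x Z0 cZ.
suff /eqP : x - y = 0 by rewrite subr_eq0 => /eqP ->.
apply/eqP; apply: contraT => xy0.
set v := x - y in xy0.
have vv : 0 < dot v v by rewrite lt_neqAle eq_sym dot_eq0 xy0 dot_ge0.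
have opt z : Z z -> dot v (z - y) <= 0.
  move=> Zz; rewrite leNgt; apply/negP => h.
  set w := z - y in h; have ww : 0 <= dot w w by exact: dot_ge0.
  (* A step [t] from [y] towards [z] changes the squared distance by [- t (2 <v, w> - t <w, w>)],
     which is negative once [t <w, w> <= <v, w>]. The added 1 keeps the denominator positive. *)
  pose t := Num.min 1 (dot v w / (dot w w + 1)).
  have w1 : 0 < dot w w + 1 by rewrite ltr_wpDl.
  have t0 : 0 < t by rewrite lt_min ltr01 divr_gt0.
  have t1 : t <= 1 by rewrite ge_min lexx.
  have tw : t * dot w w <= dot v w.
    apply: (@le_trans _ _ (t * (dot w w + 1))); first by rewrite ler_pM2l// lerDl.
    by rewrite -ler_pdivlMr// ge_min lexx orbT.
  have := yP _ (vZ z y t Zz Zy _); rewrite ltW// t1 => /(_ isT).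
  have -> : x - (t *: z + (1 - t) *: y) = v - t *: w.
    by rewrite /v /w; apply/rowP => i; rewrite !mxE; ring.
  rewrite -/v -ler_sqr ?nnegrE ?euclid_norm_ge0// !sqr_euclid_norm.
  rewrite dot_subZ; apply/negP; rewrite -ltNge.
  have : 0 < t * (2 * dot v w - t * dot w w) by rewrite mulr_gt0//; lra.
  lra.
have [z Zz zP] := supp v.
have := opt z Zz; rewrite dotDr dotNr => zy.
have : dot v y < dot v x.
  by rewrite -subr_gt0 -dotNr -dotDr.
have := dot_le_norm v x.
have vn : 0 < euclid_norm v.
  by rewrite lt_neqAle eq_sym euclid_norm_eq0 xy0 euclid_norm_ge0.
have := ltr_pM2r vn (euclid_norm x) r; rewrite xr (mulrC (euclid_norm x)); lra.
Qed.

End ball_zonoid.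

(** * Riemann sums for the mean width give zonotopes close to the ball *)

Section zonotope_approximation.
Context {R : realType}.
Implicit Types n k m : nat.

Definition grid n M (k : {ffun 'I_n -> 'I_M.*2.+1}) : 'rV[R]_n :=
  \row_i ((k i)%:R / M%:R - 1).

(** Half-open cells of side [1 / M], so that they partition the ball. The indices run up to [2 M]
    inclusive because a coordinate may equal 1. *)
Definition grid_cell n M (k : {ffun 'I_n -> 'I_M.*2.+1}) : set 'rV[R]_n :=
  unit_ball R n `&` [set g | forall i, (k i)%:R <= M%:R * (g ord0 i + 1) < (k i).+1%:R].

Lemma measurable_grid_cell n M (k : {ffun 'I_n -> 'I_M.*2.+1}) :
  measurable (grid_cell k).
Proof.
apply: measurableI; first exact: measurable_unit_ball.
rewrite [X in measurable X](_ : _ = \bigcap_(i in [set: 'I_n]) ((fun g : 'rV[R]_n => M%:R * (g ord0 i + 1)) @^-1`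
      `[(k i)%:R, (k i).+1%:R[%classic)); last first.
  apply/seteqP; split => g /= h i; last by have := h i Logic.I; rewrite /= in_itv.
  by move=> _; rewrite /= in_itv/= h.
apply: fin_bigcap_measurable => // i _; rewrite -[X in measurable X]setTI.
suff : measurable_fun [set: 'rV[R]_n] (fun g => M%:R * (g ord0 i + 1)) by exact.
apply: measurable_funM => //; apply: measurable_funD => //; exact: measurable_coord.
Qed.

Lemma grid_cell_near n M (k : {ffun 'I_n -> 'I_M.*2.+1}) g : (0 < M)%N ->
  grid_cell k g -> euclid_norm (g - grid k) <= n%:R / M%:R.
Proof.
move=> M0 [_ gk]; apply: le_trans (euclid_norm_le_sum _) _.
have Mp : 0 < M%:R :> R by rewrite ltr0n.
apply: (@le_trans _ _ (\sum_(i < n) M%:R^-1)); last first.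
  by rewrite sumr_const card_ord -[_ *+ n]mulr_natl.
apply: ler_sum => i _; rewrite !mxE; have := gk i.
rewrite -(ler_pM2l Mp) -[X in X * `|_|](gtr0_norm Mp) -normrM divff ?lt0r_neq0//.
rewrite (_ : _ * (_ - _) = M%:R * (g ord0 i + 1) - (k i)%:R); last first.
  by field; exact: lt0r_neq0.
by rewrite -natr1 => /andP[? ?]; rewrite ler_norml; lra.
Qed.

Lemma grid_cell_exists n M g : (0 < M)%N -> unit_ball R n g ->
  exists k : {ffun 'I_n -> 'I_M.*2.+1}, grid_cell k g /\
    forall k' : {ffun 'I_n -> 'I_M.*2.+1}, grid_cell k' g -> k' = k.
Proof.
move=> M0 g1; have Mp : 0 < M%:R :> R by rewrite ltr0n.
have gi i : 0 <= M%:R * (g ord0 i + 1) <= M.*2%:R.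
  have := le_trans (coord_le_euclid_norm g i) g1; rewrite ler_norml => /andP[h1 h2].
  apply/andP; split; first by apply: mulr_ge0; [exact: ltW|lra].
  by rewrite -muln2 natrM ler_pM2l//; lra.
have kP i : (Num.truncn (M%:R * (g ord0 i + 1)) < M.*2.+1)%N.
  have /andP[h1 h2] := gi i; rewrite ltnS -(ler_nat R).
  by apply: le_trans h2; rewrite truncn_le.
exists [ffun i => Ordinal (kP i)]; split.
  by split => // i; rewrite ffunE /=; apply: truncn_itv; have /andP[] := gi i.
move=> k' [_ h]; apply/ffunP => i; apply/val_inj; rewrite ffunE /=.
by apply/esym/truncn_def.
Qed.

(** [S] is a Riemann sum of the integral. On a cell the integrand differs from its value at the
    corner by at most [|x|] times the distance to it, bounded by [n / M]; integration over the ball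
    brings the factor [kappa n]. *)
Lemma mean_width_grid n M (x : 'rV[R]_n) : (0 < M)%N ->
  let S := \sum_k fine (vol (grid_cell (M := M) k)) * `|dot x (grid k)| in
  let e := euclid_norm x * (n%:R / M%:R) * kappa n in
  (mean_width x <= (S + e)%:E)%E /\ (S%:E <= mean_width x + e%:E)%E.
Proof.
move=> M0 S e.
have mB := @measurable_unit_ball R n.
pose s g := (\sum_k (`|dot x (grid k)|%:E * (\1_(grid_cell (M := M) k) g)%:E))%E.
have ms : measurable_fun setT s.
  apply: emeasurable_sum => k; apply: measurable_funeM; apply/measurable_EFinP.
  by apply: measurable_indic; exact: measurable_grid_cell.
have sE g : unit_ball R n g -> exists2 k, grid_cell (M := M) k g & s g = `|dot x (grid k)|%:E.
  move=> /(grid_cell_exists M0)[k [gk kP]]; exists k => //.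
  rewrite /s (bigD1 k)//= indicE mem_set// mule1 big1 ?adde0// => k' k'k.
  rewrite indicE memNset ?mule0// => /kP kk.
  by rewrite kk eqxx in k'k.
have s0 g : (0 <= s g)%E.
  by apply: sume_ge0 => k _; rewrite mule_ge0// lee_fin.
have SE : (\int[vol (n := n)]_(g in unit_ball R n) s g = S%:E)%E.
  rewrite ge0_integral_sum//; last first.
    move=> k; apply: measurable_funTS; apply: measurable_funeM; apply/measurable_EFinP.
    by apply: measurable_indic; exact: measurable_grid_cell.
  rewrite /S -sumEFin; apply: eq_bigr => k _; have mk := measurable_grid_cell k.
  rewrite ge0_integralZl//; last first.
    by apply/measurable_EFinP; exact: measurable_indic.
  rewrite integral_indic// (_ : _ `&` _ = grid_cell k); last first.
    by apply/seteqP; split => g []//; move=> Bg kg; split.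
  rewrite EFinM muleC fineK//.
  rewrite ge0_fin_numE ?vol_ge0//; apply: (@le_lt_trans _ _ (vol (unit_ball R n))).
    by apply: le_vol => // g [].
  by rewrite vol_unit_ballE ltry.
have e0 : 0 <= euclid_norm x * (n%:R / M%:R).
  by rewrite mulr_ge0 ?euclid_norm_ge0// divr_ge0.
have eE : (\int[vol (n := n)]_(g in unit_ball R n) (cst (euclid_norm x * (n%:R / M%:R))%:E g) = e%:E)%E.
  by rewrite integral_cst// /= vol_unit_ballE -EFinM.
have close g : unit_ball R n g ->
    exists2 r, s g = `|r|%:E & `|dot x g - r| <= euclid_norm x * (n%:R / M%:R).
  move=> /sE[k gk sk]; exists (dot x (grid k)) => //.
  rewrite -dotNr -dotDr (le_trans (abs_dot_le_norm _ _))// ler_wpM2l ?euclid_norm_ge0//.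
  exact: grid_cell_near.
have ms' : measurable_fun (unit_ball R n) s by exact: measurable_funTS.
have md : measurable_fun (unit_ball R n) (fun g => `|dot x g|%:E)%E.
  by apply: measurable_funTS; exact: measurable_abs_dot.
rewrite EFinD -SE -eE; split.
  rewrite -ge0_integralD//.
  apply: ge0_le_integral => //; first exact: emeasurable_funD.
  move=> g /close[r -> h]; rewrite -EFinD lee_fin -lerBlDl.
  exact: le_trans (lerB_dist _ _) h.
rewrite -ge0_integralD//.
apply: ge0_le_integral => //; first exact: emeasurable_funD.
move=> g /close[r -> h]; rewrite -EFinD lee_fin -lerBlDl.
by apply: le_trans (lerB_dist _ _) _; rewrite distrC.
Qed.

(** The generators are the grid points weighted by cell volume over [a], so the support function is
    a Riemann sum for [mean_width v / a], the norm of [v]. Support functions within [e |v|] of the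
    norm give the two inclusions. *)
Lemma zonotope_near_ball n (e : R) : 0 < e ->
  exists2 us : seq 'rV[R]_n, (forall x, euclid_norm x < 1 - e -> zonotope us x) &
    forall x, zonotope us x -> euclid_norm x <= 1 + e.
Proof.
move=> e0; have [a a0 aP] := mean_width_proportional (R := R) n.
(* Fine enough for the error of the Riemann sum, divided by [a], to be at most [e] times the
   norm. *)
pose M := (Num.truncn (n%:R * kappa n / (e * a) : R)).+1.
have ea : 0 < e * a by rewrite mulr_gt0.
have Mp : 0 < M%:R :> R by rewrite ltr0n.
have Me : n%:R / M%:R * kappa n <= e * a.
  rewrite mulrAC ler_pdivrMr// -ler_pdivrMl// mulrC.
  by rewrite ltW// truncnS_gt.
pose us := [seq (fine (vol (grid_cell k)) / a) *: grid k | k : {ffun 'I_n -> 'I_M.*2.+1} <- enum {ffun 'I_n -> 'I_M.*2.+1}].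
have supp v : `|\sum_(u <- us) `|dot v u| - euclid_norm v| <= e * euclid_norm v.
  have [] := mean_width_grid v (isT : (0 < M)%N).
  set S := \sum_k _; set d := _ * kappa n => h1 h2.
  have -> : \sum_(u <- us) `|dot v u| = S / a.
    rewrite big_map big_enum /S mulr_suml; apply: eq_bigr => k _.
    rewrite dotZr normrM ger0_norm; first by rewrite mulrAC.
    by apply: divr_ge0; [rewrite fine_ge0 ?vol_ge0|exact: ltW].
  have de : d <= e * a * euclid_norm v.
    by rewrite /d -mulrA mulrC ler_wpM2r ?euclid_norm_ge0.
  rewrite -(ler_pM2r a0) -[X in `|_| * X](gtr0_norm a0) -normrM mulrBl divfK ?lt0r_neq0//.
  move: h1 h2; rewrite aP -EFinD !lee_fin => h1 h2; rewrite ler_norml; lra.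
exists us.
  apply: convex_body_ball_sub; first exact: convex_body_zonotope.
  move=> v; have [z Zz zE] := zonotope_support_attained us v.
  by exists z => //; rewrite zE; have := supp v; rewrite ler_norml; lra.
move=> x Zx; have [->|x0] := eqVneq x 0; first by rewrite euclid_norm0; lra.
have nx : 0 < euclid_norm x by rewrite lt_neqAle eq_sym euclid_norm_eq0 x0 euclid_norm_ge0.
(* Here [x] serves as its own test direction: [<x, x>] is at most the support function at [x]. *)
rewrite -(ler_pM2r nx) -expr2 sqr_euclid_norm.
by have := zonotope_support_le x Zx; have := supp x; rewrite ler_norml; lra.
Qed.

End zonotope_approximation.

(** * The Steiner formula *)

Section steiner.
Context {R : realType}.
Implicit Types n k m : nat.

(** If the degree [d] exceeded [n], dividing by [c^(d-1)] would bound [|p_d| c] by a constant for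
    all [c >= 1]. *)
Lemma size_poly_growth (p : {poly R}) (C : R) n :
  (forall c, 1 <= c -> `|p.[c]| <= C * c ^+ n) -> (size p <= n.+1)%N.
Proof.
move=> pC; rewrite leqNgt; apply/negP => sp.
have [d sd] : exists d, size p = d.+1 by exists (size p).-1; rewrite prednK// (leq_trans _ sp).
have nd : (n < d)%N by rewrite sd ltnS in sp.
have C0 : 0 <= C by have := pC 1 (lexx _); rewrite expr1n mulr1; apply: le_trans.
have a0 : p`_d != 0 by have := lead_coef_eq0 p; rewrite lead_coefE sd /= -size_poly_eq0 sd => ->.
pose S := \sum_(i < d) `|p`_i|.
have S0 : 0 <= S by apply: sumr_ge0.
have key c : 1 <= c -> `|p`_d| * c <= S + C.
  move=> c1; have c0 : 0 < c by exact: lt_le_trans c1.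
  have cd : 0 < c ^+ d.-1 by rewrite exprn_gt0.
  have dE : d = d.-1.+1 by rewrite prednK// (leq_ltn_trans _ nd).
  rewrite -(ler_pM2r cd) -mulrA -exprS -dE.
  have -> : `|p`_d| * c ^+ d = `|p.[c] - \sum_(i < d) p`_i * c ^+ i|.
    rewrite [X in X - _](horner_coef_wide _ (n := d.+1)) ?sd// big_ord_recr /= addrAC subrr add0r.
    by rewrite normrM (ger0_norm (exprn_ge0 _ (ltW c0))).
  apply: le_trans (ler_normB _ _) _; rewrite mulrDl addrC; apply: lerD.
    apply: le_trans (ler_norm_sum _ _ _) _; rewrite mulr_suml; apply: ler_sum => i _.
    rewrite normrM (ger0_norm (exprn_ge0 _ (ltW c0))) ler_wpM2l//.
    by apply: ler_weXn2l => //; rewrite -ltnS -dE.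
  apply: le_trans (pC c c1) _; rewrite ler_wpM2l//.
  by apply: ler_weXn2l => //; rewrite -ltnS -dE.
have pd : 0 < `|p`_d| by rewrite normr_gt0.
have := key (1 + (S + C) / `|p`_d|); rewrite lerDl divr_ge0 ?addr_ge0// => /(_ isT).
by rewrite mulrDr mulr1 [`|_| * (_ / _)]mulrC divfK ?normr_eq0//; lra.
Qed.

Lemma convex_scale_sub n (K : set 'rV[R]_n) t x : convex_body K -> K 0 ->
  0 <= t <= 1 -> K x -> K (t *: x).
Proof.
move=> [_ _ /convex_setP vK] K0 t01 Kx.
by have := vK _ _ _ Kx K0 t01; rewrite scaler0 addr0.
Qed.

(** As [0] is in [K], the body [K] lies in [s K], and a ball of radius [c] lies in one of radius
    [s d]. *)
Lemma parallel_body_sub_dilate n (K : set 'rV[R]_n) s c d : convex_body K -> K 0 ->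
  1 <= s -> 0 <= c -> 0 <= d -> c <= s * d ->
  parallel_body K c `<=` dilate s (parallel_body K d).
Proof.
move=> bK K0 s1 c0 d0 cd x /(parallel_bodyP _ _ c0)[y Ky xy].
have s0 : 0 < s by exact: lt_le_trans s1.
rewrite dilateE ?lt0r_neq0//=; apply/(parallel_bodyP _ _ d0); exists (s^-1 *: y).
  apply: convex_scale_sub => //; rewrite invr_ge0 ltW//= invf_le1//.
have si : 0 <= s^-1 by rewrite invr_ge0 ltW.
by rewrite -scalerBr euclid_normZ ger0_norm// ler_pdivrMl// (le_trans xy).
Qed.

Definition parallel_volume n (K : set 'rV[R]_n) c : R := fine (vol (parallel_body K c)).

Lemma parallel_volumeE n (K : set 'rV[R]_n) c : convex_body K ->
  vol (parallel_body K c) = (parallel_volume K c)%:E.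
Proof. by move=> bK; rewrite fineK//; exact/convex_body_fin_num/convex_body_parallel. Qed.

Lemma parallel_volume_ge0 n (K : set 'rV[R]_n) c : 0 <= parallel_volume K c.
Proof. by rewrite fine_ge0// vol_ge0. Qed.

(** With [s = 1] this is monotonicity in the radius; with [s] close to 1 it plays the role of
    continuity. *)
Lemma parallel_volume_le n (K : set 'rV[R]_n) s c d : convex_body K -> K 0 ->
  1 <= s -> 0 <= c -> 0 <= d -> c <= s * d ->
  parallel_volume K c <= s ^+ n * parallel_volume K d.
Proof.
move=> bK K0 s1 c0 d0 cd; rewrite -lee_fin EFinM -!parallel_volumeE//.
have s0 : 0 < s by exact: lt_le_trans s1.
have bP := convex_body_parallel d bK.
rewrite -vol_dilate//; last exact: convex_body_measurable.
apply: le_vol; last exact: parallel_body_sub_dilate.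
  by apply: convex_body_measurable; exact: convex_body_parallel.
by apply: convex_body_measurable; exact: convex_body_dilate.
Qed.

(** For a zonotope [Z] between the balls of radii [1 - e] and [1 + e], the polynomial
    [vol (K + c Z)] lies between the parallel volumes at [(1 - e) c] and [(1 + e) c], which
    [parallel_volume_le] compares with the one at [c]. *)
Lemma parallel_volume_near_poly n (K : set 'rV[R]_n) (e : R) : convex_body K -> K 0 ->
  0 < e < 1 -> exists2 p : {poly R}, (size p <= n.+1)%N & forall c, 0 <= c ->
    (1 - e) ^+ n * parallel_volume K c <= p.[c] <= (1 + e) ^+ n * parallel_volume K c.
Proof.
move=> bK K0 /andP[e0 e1].
(* Half of [e], because the zonotope is only known to contain an open ball and has to contain the
   closed one of radius [1 - e]. *)
have [us usl usu] := @zonotope_near_ball R n (e / 2) ltac:(lra).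
have [p pE] := vol_msum_zonotope us bK.
have bM c := convex_body_msum bK (convex_body_dilate c (convex_body_zonotope us)).
have pc c : 0 <= c ->
    (1 - e) ^+ n * parallel_volume K c <= p.[c] <= (1 + e) ^+ n * parallel_volume K c.
  move=> c0; apply/andP; split.
    apply: (@le_trans _ _ (parallel_volume K ((1 - e) * c))).
      rewrite -ler_pdivlMl ?exprn_gt0//; last by lra.
      rewrite -exprVn; apply: parallel_volume_le => //.
      - by rewrite invf_ge1; lra.
      - by rewrite mulr_ge0//; lra.
      - by rewrite mulKf//; lra.
    rewrite -lee_fin -pE// -parallel_volumeE//; apply: le_vol.
    - by apply: convex_body_measurable; exact: convex_body_parallel.
    - exact: convex_body_measurable.
    - move=> _ [y Ky [b b1 <-]]; exists y => //; exists (c *: ((1 - e) *: b)); last first.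
        by rewrite scalerA mulrC.
      exists ((1 - e) *: b) => //; apply: usl.
      rewrite euclid_normZ ger0_norm; last by lra.
      apply: (@le_lt_trans _ _ (1 - e)); last by lra.
      by rewrite ler_piMr//; lra.
  apply: (@le_trans _ _ (parallel_volume K ((1 + e) * c))); last first.
    by apply: parallel_volume_le => //; [lra|rewrite mulr_ge0//; lra].
  rewrite -lee_fin -pE// -parallel_volumeE//; apply: le_vol.
  - exact: convex_body_measurable.
  - by apply: convex_body_measurable; exact: convex_body_parallel.
  - move=> _ [y Ky [_ [z /usu zn <-] <-]].
    apply/parallel_bodyP; first by rewrite mulr_ge0//; lra.
    exists y => //; rewrite addrAC subrr add0r euclid_normZ ger0_norm// mulrC.
    by rewrite ler_wpM2r//; lra.
(* The degree bound comes from growth: for [c >= 1] the body [K + c B] lies in the dilate of [K + B]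
   by [2 c], so [p] grows at most like [c^n]. *)
exists p => //; apply: (@size_poly_growth _ ((1 + e) ^+ n * 2 ^+ n * parallel_volume K 1)) => c c1.
have c0 : 0 <= c by lra.
have /andP[p1 p2] := pc c c0.
rewrite ger0_norm; last first.
  by apply: le_trans p1; rewrite mulr_ge0 ?parallel_volume_ge0// exprn_ge0//; lra.
apply: le_trans p2 _; rewrite -!mulrA ler_wpM2l ?exprn_ge0//; first by lra.
rewrite [parallel_volume K 1 * _]mulrC mulrA -exprMn.
apply: parallel_volume_le => //; lra.
Qed.

(** [2^n - 1] is the slope of the chord of [(1 + e)^n] over [[0, 1]]; the same slope serves for the
    lower bound. *)
Lemma expr_near1_le n (e : R) : 0 <= e <= 1 ->
  1 - (2 ^+ n - 1) * e <= (1 - e) ^+ n /\ (1 + e) ^+ n <= 1 + (2 ^+ n - 1) * e.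
Proof.
move=> /andP[e0 e1]; elim: n => [|n [IH1 IH2]]; first by rewrite !expr0; lra.
have a0 : 0 <= 2 ^+ n - 1 :> R by rewrite subr_ge0 exprn_ege1// ler1n.
rewrite !exprSr; move: (2 ^+ n) IH1 IH2 a0 => a IH1 IH2 a0.
have h1 : 0 <= 1 - e by lra.
have h2 : 0 <= 1 + e by lra.
have := ler_wpM2r h1 IH1; have := ler_wpM2r h2 IH2.
have e2 : 0 <= e * e by exact: mulr_ge0.
have := mulr_ge0 a0 e2; have := mulr_ge0 a0 e0; have : e * e <= e by rewrite ler_piMr.
move=> ee ae aee; split; first by nra.
by nra.
Qed.

(** The polynomial is the Lagrange interpolant of the parallel volume at [0, ..., n]. A polynomial
    of degree at most [n] equals its own interpolant, so approximation within a multiple of [e] at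
    [c] and at the nodes bounds the interpolation error at [c]; then [e] tends to 0. *)
Lemma parallel_volume_poly n (K : set 'rV[R]_n) : convex_body K -> K 0 ->
  exists2 p : {poly R}, (size p <= n.+1)%N &
    forall c, 0 <= c -> parallel_volume K c = p.[c].
Proof.
move=> bK K0; pose F := parallel_volume K.
have F0 c : 0 <= F c by exact: parallel_volume_ge0.
have inj : injective (fun i : nat => i%:R : R) by move=> i j /eqP; rewrite eqr_nat => /eqP.
pose L (i : 'I_n.+1) : {poly R} := (qpoly.lagrange n.+1 (fun i => i%:R : R))`_i.
have Lgen (p : {poly R}) : (size p <= n.+1)%N -> p = \sum_(i < n.+1) p.[i%:R] *: L i.
  move=> sp; rewrite [LHS](qpoly.lagrange_gen _ inj sp)//; apply: eq_bigr => i _.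
  by rewrite mul_polyC /L qpoly.nth_lagrange.
exists (\sum_(i < n.+1) F i%:R *: L i).
  apply: (leq_trans (size_sum _ _ _)); apply/bigmax_leqP => i _.
  by rewrite (leq_trans (size_scale_leq _ _))// /L qpoly.nth_lagrange qpoly.size_lagrange_.
move=> c c0; set P := \sum_(i < _) _; apply/eqP; rewrite -subr_eq0 -normr_le0.
pose A := F c + \sum_(i < n.+1) F i%:R * `|(L i).[c]|.
have A0 : 0 <= A by rewrite addr_ge0 ?F0//; apply: sumr_ge0 => i _; rewrite mulr_ge0.
have step e : 0 < e < 1 -> `|F c - P.[c]| <= 2 ^+ n * e * A.
  move=> e01; have [p sp pF] := parallel_volume_near_poly bK K0 e01.
  have near d : 0 <= d -> `|F d - p.[d]| <= 2 ^+ n * e * F d.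
    move=> d0; have /andP[h1 h2] := pF d d0.
    have [|g1 g2] := @expr_near1_le n e; first by lra.
    have := ler_wpM2r (F0 d) g1; have := ler_wpM2r (F0 d) g2.
    have : 0 <= e * F d by rewrite mulr_ge0//; lra.
    move: h1 h2; rewrite -/F ler_norml; move: (2 ^+ n) => a.
    move: ((1 + e) ^+ n) ((1 - e) ^+ n) => u v; lra.
  (* Interpolation reproduces [p], so [p] can be inserted on both sides; [A] collects the resulting
     weights and depends neither on [e] nor on [p]. *)
  have -> : F c - P.[c] = (F c - p.[c]) - \sum_(i < n.+1) (F i%:R - p.[i%:R]) * (L i).[c].
    under [in RHS]eq_bigr do rewrite mulrBl.
    rewrite sumrB /P {1}(Lgen p sp) !horner_sum.
    under eq_bigr do rewrite hornerZ; under [in RHS]eq_bigr do rewrite hornerZ.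
    by rewrite opprB addrA subrK.
  apply: le_trans (ler_normB _ _) _; rewrite mulrDr; apply: lerD; first exact: near.
  apply: le_trans (ler_norm_sum _ _ _) _; rewrite mulr_sumr; apply: ler_sum => i _.
  by rewrite normrM mulrA ler_wpM2r// near.
apply/ler_addgt0Pr => d d0; rewrite add0r.
have h : 0 < 2 ^+ n * A + 1 by rewrite ltr_wpDl// mulr_ge0// exprn_ge0.
pose e := Num.min (1 / 2) (d / (2 ^+ n * A + 1)).
have e01 : 0 < e < 1.
  by rewrite lt_min gt_min !divr_gt0//=; apply/orP; left; lra.
apply: le_trans (step e e01) _; rewrite mulrAC.
apply: (@le_trans _ _ ((2 ^+ n * A + 1) * e)).
  by rewrite ler_wpM2r//; lra.
by rewrite mulrC -ler_pdivlMr// ge_min lexx orbT.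
Qed.

Lemma steiner_exists n (K : set 'rV[R]_n) : convex_body K -> K 0 ->
  steiner_formula K (intrinsic_volume K).
Proof.
move=> bK K0; apply: getPex; have [p sp pF] := parallel_volume_poly bK K0.
(* The Steiner formula indexes by codimension: [V_i] belongs to the power [n - i], hence the
   reversal of the sum below. *)
exists (fun i : 'I_n.+1 => p`_(n - i) / kappa (n - i)) => c c0.
rewrite parallel_volumeE// pF// (horner_coef_wide _ sp) (reindex_inj rev_ord_inj) /=.
congr EFin; apply: eq_bigr => i _; rewrite subSS.
by rewrite [kappa _ * _]mulrC divfK// lt0r_neq0// kappa_gt0.
Qed.

End steiner.

(** * The Gaussian representation *)

Section gaussian_representation.
Context {R : realType}.
Implicit Types n k m : nat.
Notation leb := (@lebesgue_measure R).
Notation mR := (measurableTypeR R).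

(* [s <= gauss K x] if and only if [x] is within [radius s] of [K]. *)
Definition radius (s : R) : R := Num.sqrt (- ln s / pi).

Definition euclid_dist n (K : set 'rV[R]_n) (x : 'rV[R]_n) : R :=
  inf [set euclid_norm (x - y) | y in K].

Lemma euclid_distP n (K : set 'rV[R]_n) x : K !=set0 -> compact K ->
  exists2 y, K y & euclid_dist K x = euclid_norm (x - y).
Proof.
move=> K0 cK; have [y Ky yP] := nearest_point x K0 cK; exists y => //.
apply/eqP; rewrite eq_le; apply/andP; split.
  apply: ge_inf; last by exists y.
  by exists 0 => _ [z _ <-]; exact: euclid_norm_ge0.
apply: lb_le_inf; first by exists (euclid_norm (x - y)); exists y.
by move=> _ [z Kz <-]; exact: yP.
Qed.

Lemma euclid_dist_le n (K : set 'rV[R]_n) x y : K y -> euclid_dist K x <= euclid_norm (x - y).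
Proof.
move=> Ky; apply: ge_inf; last by exists y.
by exists 0 => _ [z _ <-]; exact: euclid_norm_ge0.
Qed.

Lemma euclid_dist_ge0 n (K : set 'rV[R]_n) x : convex_body K -> 0 <= euclid_dist K x.
Proof. by move=> [K0 cK _]; have [y _ ->] := euclid_distP x K0 cK; exact: euclid_norm_ge0. Qed.

Lemma parallel_body_dist n (K : set 'rV[R]_n) r : convex_body K -> 0 <= r ->
  parallel_body K r = [set x | euclid_dist K x <= r].
Proof.
move=> [K0 cK _] r0; apply/seteqP; split => x /=.
  by move=> /(parallel_bodyP _ _ r0)[y Ky]; exact/le_trans/euclid_dist_le.
by have [y Ky ->] := euclid_distP x K0 cK => xr; apply/(parallel_bodyP _ _ r0); exists y.
Qed.

Lemma measurable_euclid_dist n (K : set 'rV[R]_n) : convex_body K ->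
  measurable_fun [set: 'rV[R]_n] (euclid_dist K).
Proof.
move=> bK; apply: (measurability _ (RGenOInfty.measurableE R)).
move=> _ [_ [r ->] <-]; rewrite setTI.
have -> : euclid_dist K @^-1` `]r, +oo[%classic = ~` [set x | euclid_dist K x <= r].
  by apply/seteqP; split => x /=; rewrite in_itv/= andbT ltNge => /negP.
apply: measurableC; have [r0|r0] := leP 0 r.
  by rewrite -parallel_body_dist//; apply: convex_body_measurable; exact: convex_body_parallel.
rewrite (_ : [set x | _] = set0)//; apply/seteqP; split => x //=.
by move=> /(le_trans (euclid_dist_ge0 x bK)); rewrite leNgt r0.
Qed.

Definition gauss n (K : set 'rV[R]_n) (x : 'rV[R]_n) : R :=
  expR (- (pi * euclid_dist K x ^+ 2)).

Lemma measurable_gauss n (K : set 'rV[R]_n) : convex_body K ->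
  measurable_fun [set: 'rV[R]_n] (gauss K).
Proof.
move=> bK; apply: measurableT_comp; first exact: measurable_expR.
apply: measurableT_comp => //; apply: measurable_funM => //.
by apply: measurable_funX; exact: measurable_euclid_dist.
Qed.

Lemma gauss_gt0 n (K : set 'rV[R]_n) x : 0 < gauss K x.
Proof. exact: expR_gt0. Qed.

Lemma gauss_le1 n (K : set 'rV[R]_n) x : gauss K x <= 1.
Proof. by rewrite -expR0 ler_expR oppr_le0 mulr_ge0 ?sqr_ge0// pi_ge0. Qed.

(** Kept in the extended reals, where Tonelli applies to nonnegative functions without integrability
    conditions. *)
Definition gauss_wills n (K : set 'rV[R]_n) : \bar R :=
  (\int[leb]_(s in `]0%R, 1%R[) vol (parallel_body K (radius s)))%E.

Lemma radius_ge0 s : 0 <= radius s. Proof. exact: sqrtr_ge0. Qed.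

Lemma le_gauss n (K : set 'rV[R]_n) x s : convex_body K -> 0 < s < 1 ->
  (s <= gauss K x) = (euclid_dist K x <= radius s).
Proof.
move=> bK /andP[s0 s1]; rewrite -[LHS]ler_ln ?posrE ?gauss_gt0// [in LHS]/gauss expRK.
have ln0 : 0 <= - ln s by rewrite oppr_ge0 ln_le0// ltW.
have p0 : 0 < pi :> R by exact: pi_gt0.
rewrite -[RHS]ler_sqr ?nnegrE ?euclid_dist_ge0 ?radius_ge0// sqr_sqrtr; last by rewrite divr_ge0 ?pi_ge0.
by rewrite ler_pdivlMr// lerNr mulrC.
Qed.

(** Both sides measure the region [D] under the graph of [gauss K]: its sections at height [s] are
    parallel bodies, those over [x] are intervals of length [gauss K x]. *)
Lemma integral_gauss n (K : set 'rV[R]_n) : convex_body K ->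
  gauss_wills K = (\int[vol (n := n)]_x (gauss K x)%:E)%E.
Proof.
move=> bK; pose D : set (mR * 'rV[R]_n) := [set p | 0 < p.1 < 1 /\ p.1 <= gauss K p.2].
have mD : measurable D.
  apply: measurableI.
    rewrite [X in measurable X](_ : _ = fst @^-1` `]0, 1[%classic); last first.
      by apply/seteqP; split => p /=; rewrite in_itv.
    by rewrite -[X in measurable X]setTI; exact: measurable_fst.
  have mg : measurable_fun [set: mR * 'rV[R]_n] (fun p => gauss K p.2).
    exact: measurableT_comp (measurable_gauss bK) measurable_snd.
  have m1 : measurable_fun [set: mR * 'rV[R]_n] (fun p => p.1 : R) by exact: measurable_fst.
  rewrite [X in measurable X](_ : _ = (fun p : mR * 'rV[R]_n => gauss K p.2 - p.1) @^-1` `[0, +oo[%classic).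
    by rewrite -[X in measurable X]setTI; apply: measurable_funB.
  by apply/seteqP; split => p /=; rewrite in_itv/= andbT subr_ge0.
transitivity (\int[leb]_s vol [set x | D (s, x)])%E.
  rewrite /gauss_wills integral_mkcond; apply: eq_integral => s _.
  rewrite patchE; case: ifPn => [|/negP]; rewrite inE/= in_itv/= => s01.
    rewrite parallel_body_dist// ?radius_ge0//; congr vol.
    by apply/seteqP; split => x /=; rewrite -le_gauss//; last (by case); split.
  rewrite -[LHS](@vol_set0 R n); congr vol.
  by apply/seteqP; split => x //= [].
rewrite (vol_sections leb (@vol R n) mD); apply: eq_integral => x _.
have g0 := gauss_gt0 K x; have g1 := gauss_le1 K x.
(* Since [D] excludes height 1, the section is open at the top when [gauss K x = 1] and closed
   otherwise. *)
have [ge1|lt1] := eqVneq (gauss K x) 1.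
  rewrite ge1 (_ : [set s | _] = `]0%R, 1%R[%classic).
    by have := lebesgue_measure_itv `]0%R, 1%R[ => /= ->; rewrite lte_fin ltr01 oppr0 adde0.
  apply/seteqP; split => s /=; rewrite in_itv/= /D /= ge1; first by case.
  by move=> s01; split => //; lra.
rewrite (_ : [set s | _] = `]0%R, gauss K x]%classic).
  by have := lebesgue_measure_itv `]0%R, gauss K x] => /= ->; rewrite lte_fin g0 oppr0 adde0.
have {}lt1 : gauss K x < 1 by rewrite lt_neqAle lt1.
apply/seteqP; split => s /=; rewrite in_itv/= /D /=; first by move=> [/andP[-> _] ->].
by move=> /andP[-> sg]; split => //=; lra.
Qed.

Definition set_prod k m (P : set 'rV[R]_k) (L : set 'rV[R]_m) : set 'rV[R]_(k + m) :=
  [set row_mx y z | y in P & z in L].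

Lemma euclid_dist_prod k m (P : set 'rV[R]_k) (L : set 'rV[R]_m) y z :
  convex_body P -> convex_body L -> convex_body (set_prod P L) ->
  euclid_dist (set_prod P L) (row_mx y z) ^+ 2 = euclid_dist P y ^+ 2 + euclid_dist L z ^+ 2.
Proof.
move=> bP bL bPL; have [P0 cP _] := bP; have [L0 cL _] := bL; have [PL0 cPL _] := bPL.
have [p Pp pE] := euclid_distP y P0 cP; have [l Ll lE] := euclid_distP z L0 cL.
have [_ [a Pa [b Lb <-]] abE] := euclid_distP (row_mx y z) PL0 cPL.
have rB a' b' : row_mx y z - row_mx a' b' = row_mx (y - a') (z - b').
  by rewrite opp_row_mx add_row_mx.
apply/eqP; rewrite eq_le; apply/andP; split; last first.
  rewrite abE rB euclid_norm_row_mx lerD//.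
    by rewrite ler_sqr ?nnegrE ?euclid_dist_ge0 ?euclid_norm_ge0// euclid_dist_le.
  by rewrite ler_sqr ?nnegrE ?euclid_dist_ge0 ?euclid_norm_ge0// euclid_dist_le.
rewrite pE lE -euclid_norm_row_mx -rB ler_sqr ?nnegrE ?euclid_dist_ge0 ?euclid_norm_ge0//.
by apply: euclid_dist_le; exists p => //; exists l.
Qed.

Lemma convex_body_set_prod k m (P : set 'rV[R]_k) (L : set 'rV[R]_m) :
  convex_body P -> convex_body L -> convex_body (set_prod P L).
Proof.
move=> bP bL.
have -> : set_prod P L = msum [set y *m row_mx 1%:M 0 | y in P] [set z *m row_mx 0 1%:M | z in L].
  have e y z : row_mx y z = y *m row_mx 1%:M 0 + z *m row_mx 0 1%:M :> 'rV[R]_(k + m).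
    by rewrite !mul_mx_row !mulmx1 !mulmx0 add_row_mx addr0 add0r.
  apply/seteqP; split => [_ [y Py [z Lz <-]]|_ [_ [y Py <-] [_ [z Lz <-] <-]]].
    by rewrite e; exists (y *m row_mx 1%:M 0); [exists y|exists (z *m row_mx 0 1%:M); [exists z|]].
  by rewrite -e; exists y => //; exists z.
by apply: convex_body_msum; exact: convex_body_mulmxr.
Qed.

(** Squared distances add, so the Gaussians multiply and Tonelli splits the integral. With a factor
    [[set 0]] this gives independence of the embedding. *)
Lemma gauss_wills_prod k m (P : set 'rV[R]_k) (L : set 'rV[R]_m) :
  convex_body P -> convex_body L ->
  gauss_wills (set_prod P L) = (gauss_wills P * gauss_wills L)%E.
Proof.
move=> bP bL; have bPL := convex_body_set_prod bP bL.
have mP : measurable_fun setT (EFin \o gauss P) by apply/measurable_EFinP; exact: measurable_gauss.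
have mL : measurable_fun setT (EFin \o gauss L) by apply/measurable_EFinP; exact: measurable_gauss.
rewrite !integral_gauss// integral_vol_row_mx; last 2 first.
- by apply/measurable_EFinP; exact: measurable_gauss.
- by move=> x; rewrite lee_fin ltW// gauss_gt0.
rewrite -ge0_integralZr//; last 2 first.
- by move=> x _; rewrite lee_fin ltW// gauss_gt0.
- by apply: integral_ge0 => x _; rewrite lee_fin ltW// gauss_gt0.
apply: eq_integral => y _; rewrite -ge0_integralZl//; last 2 first.
- by move=> x _; rewrite lee_fin ltW// gauss_gt0.
- by rewrite lee_fin ltW// gauss_gt0.
apply: eq_integral => z _; rewrite -EFinM; congr EFin.
by rewrite /gauss euclid_dist_prod// mulrDr opprD expRD.
Qed.

Lemma convex_body_set0 n : convex_body [set (0 : 'rV[R]_n)].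
Proof.
split; [by exists 0|exact: compact_set1|].
by apply/convex_setP => _ _ t -> -> _; rewrite !scaler0 addr0.
Qed.

Lemma euclid_dist_set0 n (x : 'rV[R]_n) : euclid_dist [set 0] x = euclid_norm x.
Proof.
have [|_ -> ->] := @euclid_distP _ [set 0] x _ (@compact_set1 _ _); last by rewrite subr0.
by exists 0.
Qed.

Lemma gaussian_integral : (\int[leb]_t (expR (- (pi * t ^+ 2)))%:E = 1)%E.
Proof.
have p0 : 0 < pi :> R by exact: pi_gt0.
have pn : pi != 0 :> R by exact: lt0r_neq0.
have h1 (p : R) : p != 0 -> (2 * p)^-1 * p *+ 2 = 1 by move=> ?; rewrite -[LHS]mulr_natl; field.
have h2 (p t : R) : p != 0 -> - (p * t ^+ 2) = - t ^+ 2 / ((2 * p)^-1 *+ 2).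
  by move=> ?; rewrite -[(2 * p)^-1 *+ 2]mulr_natl; field.
(* The standard deviation for which the centred normal density has peak 1 and is exactly this
   integrand. *)
pose s : R := Num.sqrt (2 * pi)^-1.
have s2 : s ^+ 2 = (2 * pi)^-1 by rewrite sqr_sqrtr// invr_ge0 mulr_ge0// ltW.
have s0 : s != 0 by rewrite gt_eqF// sqrtr_gt0 invr_gt0 mulr_gt0.
rewrite -(integral_normal_pdf 0 s); apply: eq_integral => t _; congr EFin.
rewrite /normal_pdf (negbTE s0) /normal_peak /normal_fun s2 subr0.
rewrite [X in Num.sqrt X](_ : _ = 1); last exact: h1.
rewrite sqrtr1 invr1 mul1r; congr expR.
exact: h2.
Qed.

Lemma gauss_wills_set0 n : gauss_wills [set (0 : 'rV[R]_n)] = 1%E.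
Proof.
rewrite integral_gauss; last exact: convex_body_set0.
under eq_integral do rewrite /gauss euclid_dist_set0 sqr_euclid_norm.
elim: n => [|n IH].
  rewrite (_ : (fun x => _) = cst 1%E); last first.
    by apply/funext => x; rewrite (thinmx0 x) dot0l mulr0 oppr0 expR0.
  by rewrite integral_cst// mul1e /= indicE in_setT.
have me m : measurable_fun [set: 'rV[R]_m] (fun x => (expR (- (pi * dot x x)))%:E).
  apply/measurable_EFinP; apply: measurableT_comp; first exact: measurable_expR.
  apply: measurableT_comp => //; apply: measurable_funM => //.
  by apply: measurable_dot; exact: measurable_id.
rewrite (integral_volS (me n.+1)); last by move=> x; rewrite lee_fin expR_ge0.
rewrite -[RHS]gaussian_integral; apply: eq_integral => t _.
rewrite -[RHS]mule1 -IH -ge0_integralZl ?lee_fin ?expR_ge0//; last exact: me.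
apply: eq_integral => v _; rewrite -EFinM -expRD -opprD -mulrDr.
congr (expR (- (pi * _)))%:E; rewrite /dot big_ord_recl row_cons0 expr2; congr (_ + _).
by apply: eq_bigr => i _; rewrite row_consS.
Qed.

Lemma measurable_radius : measurable_fun [set: mR] radius.
Proof.
rewrite [X in measurable_fun _ X](_ : _ = Num.sqrt \o (fun s : mR => - ln s / pi))//.
apply: measurableT_comp; first by apply: continuous_measurable_fun; exact: sqrt_continuous.
by apply: measurable_funM => //; apply: measurableT_comp => //; exact: measurable_ln.
Qed.

Lemma radius_gt0 s : 0 < s < 1 -> 0 < radius s.
Proof.
move=> s01; rewrite sqrtr_gt0 divr_gt0 ?pi_gt0// oppr_gt0.
exact: ln_lt0.
Qed.

Lemma radius_moment j : (\int[leb]_(s in `]0%R, 1%R[) ((kappa j * radius s ^+ j)%:E) = 1)%E.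
Proof.
rewrite -(gauss_wills_set0 j); apply: eq_integral => s; rewrite inE/= in_itv/= => s01.
have r0 := radius_gt0 s01.
rewrite (_ : parallel_body _ _ = dilate (radius s) (unit_ball R j)).
  rewrite vol_dilate//; last exact: measurable_unit_ball.
  by rewrite vol_unit_ballE -EFinM mulrC.
by rewrite parallel_bodyE msumC msum0.
Qed.

Lemma wills_gauss n (K : set 'rV[R]_n) : convex_body K -> K 0 ->
  (wills K)%:E = gauss_wills K.
Proof.
move=> bK K0; have st := steiner_exists bK K0.
(* The signs of the intrinsic volumes are unknown here, so linearity is applied to integrable
   functions rather than to nonnegative ones. *)
have int j : leb.-integrable `]0%R, 1%R[%classic (fun s => ((kappa j * radius s ^+ j)%:E)).
  apply/integrableP; split.
    apply/measurable_EFinP; apply: measurable_funTS; apply: measurable_funM => //.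
    by apply: measurable_funX; exact: measurable_radius.
  under eq_integral do rewrite gee0_abs ?lee_fin ?mulr_ge0 ?exprn_ge0 ?radius_ge0 ?(ltW (kappa_gt0 _))//.
  by rewrite radius_moment ltry.
rewrite /gauss_wills.
transitivity (\int[leb]_(s in `]0%R, 1%R[) (\sum_(i < n.+1)
    (intrinsic_volume K i)%:E * (kappa (n - i) * radius s ^+ (n - i))%:E))%E.
  rewrite integral_sum//; last first.
    by move=> i; apply: integrableZl => //.
  rewrite /wills -sumEFin; apply: eq_bigr => i _.
  by rewrite integralZl// radius_moment mule1.
apply: eq_integral => s _; rewrite st ?radius_ge0// -sumEFin; apply: eq_bigr => i _.
by rewrite -EFinM; congr EFin; ring.
Qed.

End gaussian_representation.

(** * The Rogers-Shephard inequality *)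

Section rogers_shephard.
Context {R : realType}.
Implicit Types n k m : nat.
Notation leb := (@lebesgue_measure R).
Notation mR := (measurableTypeR R).

Definition fiber k m (C : set 'rV[R]_(k + m)) (y : 'rV[R]_k) : set 'rV[R]_m :=
  [set z | C (row_mx y z)].

Lemma continuous_row_mxr k m (y : 'rV[R]_k) : continuous (fun z : 'rV[R]_m => row_mx y z).
Proof.
apply: continuous_rV => i; case: (fintype.split_ordP i) => j ->.
  rewrite (_ : (fun z => _) = cst (y ord0 j)); first exact: cst_continuous.
  by apply/funext => z; rewrite row_mxEl.
rewrite (_ : (fun z => _) = (fun z : 'rV[R]_m => z ord0 j)); first exact: continuous_coord.
by apply/funext => z; rewrite row_mxEr.
Qed.

Lemma compact_fiber k m (C : set 'rV[R]_(k + m)) y : compact C -> compact (fiber C y).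
Proof.
move=> cC.
(* The projection of [C] onto the last [m] coordinates, a compact set that contains the fiber. *)
have cr : compact [set x *m col_mx (0 : 'M[R]_(k, m)) 1%:M | x in C].
  apply: continuous_compact => //; apply: continuous_subspaceT; exact: continuous_mulmxr.
apply: subclosed_compact cr _.
  rewrite (_ : fiber C y = (fun z => row_mx y z) @^-1` C)//.
  by apply: closed_comp => [z _|]; [exact: continuous_row_mxr|exact: compact_closed_rV].
by move=> z Cz; exists (row_mx y z); rewrite // mul_row_col mulmx0 mulmx1 add0r.
Qed.

Lemma convex_body_fiber k m (C : set 'rV[R]_(k + m)) y : convex_body C ->
  fiber C y !=set0 -> convex_body (fiber C y).
Proof.
move=> [_ cC /convex_setP vC] C0; split => //; first exact: compact_fiber.
apply/convex_setP => z z' t Cz Cz' t01; rewrite /fiber /=.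
have := vC _ _ t Cz Cz' t01; rewrite !scale_row_mx add_row_mx -scalerDl.
by rewrite addrC subrK scale1r.
Qed.

Definition lproj k m (C : set 'rV[R]_(k + m)) : set 'rV[R]_k := [set lsubmx x | x in C].

Lemma lsubmxE k m (x : 'rV[R]_(k + m)) : lsubmx x = x *m col_mx 1%:M (0 : 'M[R]_(m, k)).
Proof. by rewrite -{2}(hsubmxK x) mul_row_col mulmx0 mulmx1 addr0. Qed.

Lemma convex_body_lproj k m (C : set 'rV[R]_(k + m)) : convex_body C -> convex_body (lproj C).
Proof.
move=> bC; rewrite (_ : lproj C = [set x *m col_mx 1%:M (0 : 'M[R]_(m, k)) | x in C]).
  exact: convex_body_mulmxr.
by apply/seteqP; split => _ [x Cx <-]; exists x => //; rewrite lsubmxE.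
Qed.

Lemma fiber_lproj k m (C : set 'rV[R]_(k + m)) y : lproj C y <-> fiber C y !=set0.
Proof.
split=> [[x Cx <-]|[z Cz]]; first by exists (rsubmx x); rewrite /fiber /= hsubmxK.
by exists (row_mx y z); rewrite // row_mxKl.
Qed.

Lemma vol_fibers k m (C : set 'rV[R]_(k + m)) : measurable C ->
  (vol C = \int[vol (n := k)]_y vol (fiber C y))%E.
Proof.
move=> mC; transitivity (\int[vol (n := (k + m)%N)]_x (\1_C x)%:E)%E.
  by rewrite integral_indic// setIT.
rewrite integral_vol_row_mx//; last by apply/measurable_EFinP; exact: measurable_indic.
apply: eq_integral => y _.
rewrite (eq_integral (fun z => (\1_(fiber C y) z)%:E)); last first.
  by move=> z _; rewrite !indicE; congr (_%:R%:E); congr nat_of_bool;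
     apply/idP/idP; rewrite !inE.
rewrite integral_indic ?setIT//; apply: measurable_preimage mC.
apply: (@measurableT_comp _ _ _ _ _ _ (fun p => row_mx p.1 p.2) _ (fun z : 'rV[R]_m => (y, z))).
  exact: measurable_row_mx.
exact: measurable_pair1.
Qed.

Lemma measurable_vol_fiber k m (C : set 'rV[R]_(k + m)) : measurable C ->
  measurable_fun setT (fun y => vol (fiber C y)).
Proof.
move=> mC.
have -> : (fun y => vol (fiber C y)) =
    @vol R m \o xsection [set p : 'rV[R]_k * 'rV[R]_m | C (row_mx p.1 p.2)].
  by apply/funext => y /=; rewrite xsectionE.
apply: measurable_fun_xsection; apply: measurable_preimage mC; exact: measurable_row_mx.
Qed.

(* Convexity places [s *: w + (1 - s) *: fiber C 0] inside the fiber over [s *: p],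
   for [row_mx p w] in [C]. *)
Lemma vol_fiber_ge k m (C : set 'rV[R]_(k + m)) (s : R) (y : 'rV[R]_k) : convex_body C -> 0 < s < 1 ->
  lproj C y -> (((1 - s) ^+ m)%:E * vol (fiber C 0) <= vol (fiber C (s *: y)))%E.
Proof.
move=> bC s01 /fiber_lproj[w Cw].
have s1 : 0 < 1 - s by lra.
have [_ cC /convex_setP vC] := bC.
have m0 : measurable (fiber C 0) by apply: compact_measurable_rV; exact: compact_fiber.
have md : measurable (dilate (1 - s) (fiber C 0)).
  rewrite dilateE ?lt0r_neq0//; apply: measurable_preimage m0.
  by apply: measurable_scalerV; [exact: measurable_cst|exact: measurable_id].
have mt : measurable_fun [set: 'rV[R]_m] (fun x => x - s *: w).
  by apply: measurable_addrV; [exact: measurable_id|exact: measurable_cst].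
rewrite -vol_dilate// -(vol_translate (- (s *: w)))//; apply: le_vol.
- exact: (measurable_preimage mt md).
- by apply: compact_measurable_rV; exact: compact_fiber.
- move=> z /= [z' Cz' zE]; rewrite /fiber /=.
  have := vC _ _ s Cw Cz' _; rewrite !scale_row_mx add_row_mx scaler0 addr0 zE [_ + (z - _)]addrC subrK.
  by apply; lra.
Qed.

Lemma integral_onemX_ge m (a : R) : 0 <= a < 1 ->
  (\int[leb]_(s in `[a, 1%R]) (m.+1%:R * (1 - s) ^+ m)%:E = ((1 - a) ^+ m.+1)%:E)%E.
Proof.
move=> /andP[a0 a1].
pose F (s : R) := - (1 - s) ^+ m.+1.
have cF : continuous F.
  by move=> x; apply: cvgN; exact: (@continuous_onemXn R m.+1 x).
have dF x : derivable F x 1.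
  by apply: derivableN; exact: (@onemXn_derivable R m.+1 x).
rewrite (@continuous_FTC2 _ _ F)//; first last.
- move=> x _; rewrite derive1E deriveN; last exact: (@onemXn_derivable R m.+1 x).
  by rewrite -derive1E (derive_onemXn m.+1) /= mulNr opprK.
- split => //.
  + exact/cvg_at_right_filter/cF.
  + exact/cvg_at_left_filter/cF.
- apply: continuous_subspaceT => x; apply: cvgM; first exact: cvg_cst.
  exact: continuous_onemXn.
by rewrite -EFinB; congr EFin; rewrite /F subrr expr0n /=; ring.
Qed.

(** The integral is [m + 1] times a beta value, that is [k! (m+1)! / (k+m+1)!]. *)
Lemma integral_onemX_beta k m :
  (\int[leb]_(s in `[0%R, 1%R]) (m.+1%:R * (1 - s) ^+ m * s ^+ k)%:E =
   ('C(k + m.+1, k)%:R^-1)%:E)%E.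
Proof.
have := EFin_beta_fun (R := R) k.+1 m.+1.
rewrite beta_fun_fact (integral_XMonemX_restrict setT) setTI => h.
transitivity (m.+1%:R%:E * \int[leb]_(s in `[0%R, 1%R]) (XMonemX k m s)%:E)%E.
  rewrite -ge0_integralZl//; last 2 first.
  - by apply/measurable_EFinP; exact: measurable_XMonemX.
  - by move=> s; rewrite /= => s01; rewrite lee_fin XMonemX_ge0.
  by apply: eq_integral => s _; rewrite -EFinM /XMonemX /unstable.onem; congr EFin; ring.
rewrite -h -EFinM; congr EFin.
have [f1 f2 f3] : [/\ k`!%:R != 0 :> R, m`!%:R != 0 :> R & m.+1%:R != 0 :> R].
  by rewrite !pnatr_eq0 -!lt0n !fact_gt0.
have bE : 'C(k + m.+1, k)%:R * (k`!%:R * (m.+1%:R * m`!%:R)) = (k + m).+1`!%:R :> R.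
  by rewrite -!natrM -factS; have := bin_fact (leq_addr m.+1 k); rewrite addKn => ->; rewrite addnS.
have f4 : 'C(k + m.+1, k)%:R != 0 :> R by rewrite pnatr_eq0 -lt0n bin_gt0 leq_addr.
rewrite -bE natrM; move: f1 f2 f3 f4 {bE h}.
move: (k`!%:R : R) (m`!%:R : R) (m.+1%:R : R) ('C(k + m.+1, k)%:R : R) => a b c d a0 b0 c0 d0.
by field; rewrite a0 b0 c0 d0.
Qed.

End rogers_shephard.

(** * From the volumes of fibres to the Rogers-Shephard inequality *)

Section projection_section_inequalities.
Context {R : realType}.
Implicit Types n k m : nat.
Notation leb := (@lebesgue_measure R).
Notation mR := (measurableTypeR R).

(* [expR (- ln s)] is [s^-1] for [0 < s], in a form known to be measurable. *)
Definition radial k (P : set 'rV[R]_k) : set (mR * 'rV[R]_k) :=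
  [set p | 0 < p.1 <= 1 /\ P (expR (- ln p.1) *: p.2)].

Lemma radialE k (P : set 'rV[R]_k) s : 0 < s <= 1 ->
  [set y | radial P (s, y)] = dilate s P.
Proof.
move=> s01; have s0 : 0 < s by case/andP: s01.
rewrite dilateE ?lt0r_neq0// /radial /= expRN lnK ?posrE//.
by apply/seteqP; split => y /=; [case|split].
Qed.

Lemma measurable_radial k (P : set 'rV[R]_k) : measurable P -> measurable (radial P).
Proof.
move=> mP; apply: measurableI.
  rewrite [X in measurable X](_ : _ = fst @^-1` `]0, 1]%classic); last first.
    by apply/seteqP; split => p /=; rewrite in_itv.
  by rewrite -[X in measurable X]setTI; exact: measurable_fst.
rewrite -[X in measurable X]/[set p : mR * 'rV[R]_k | P (expR (- ln p.1) *: p.2)].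
apply: measurable_preimage mP; apply: measurable_scalerV; last exact: measurable_snd.
apply: measurableT_comp; first exact: measurable_expR.
apply: measurableT_comp => //.
by apply: measurableT_comp; [exact: measurable_ln|exact: measurable_fst].
Qed.

(** Its mass on [[a, 1]] is [(1 - a)^(m+1)], the factor by which [vol_fiber_ge] compares fibres of
    dimension [m + 1]. *)
Definition radial_density m s : R := m.+1%:R * (1 - s) ^+ m.

Lemma measurable_radial_density m : measurable_fun [set: mR] (radial_density m).
Proof. by apply: measurable_funM => //; apply: measurable_funX; exact: measurable_funB. Qed.

Lemma radial_density_ge0 m s : s <= 1 -> 0 <= radial_density m s.
Proof. by move=> s1; rewrite mulr_ge0// exprn_ge0// subr_ge0. Qed.

(** Let [f] and [g] be the volumes of the fibres over 0 and [y]. If [y] is in the dilate of the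
    projection by [s < 1], then [(1 - s)^(m+1) f <= g], so [1 - s] is at most the root [q] of
    [g / f]. All such [s] thus lie above [1 - q], where the density has mass at most [g / f]. *)
Lemma vol_fiber_ge_radial k m (C : set 'rV[R]_(k + m.+1)) y : convex_body C -> C 0 ->
  (vol (fiber C 0) * \int[leb]_s (radial_density m s * \1_(radial (lproj C)) (s, y))%:E
   <= vol (fiber C y))%E.
Proof.
move=> bC C0; have [_ cC _] := bC.
have [f fE] : exists f, vol (fiber C 0) = f%:E.
  by exists (fine (vol (fiber C 0))); rewrite fineK// vol_compact_fin_num//; exact: compact_fiber.
have [g gE] : exists g, vol (fiber C y) = g%:E.
  by exists (fine (vol (fiber C y))); rewrite fineK// vol_compact_fin_num//; exact: compact_fiber.
have f0 : 0 <= f by rewrite -lee_fin -fE vol_ge0.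
have g0 : 0 <= g by rewrite -lee_fin -gE vol_ge0.
rewrite fE gE; have [->|fn0] := eqVneq f 0; first by rewrite mul0e lee_fin.
have fp : 0 < f by rewrite lt_neqAle eq_sym fn0.
pose q := powR (g / f) (m.+1%:R^-1).
have q0 : 0 <= q by exact: powR_ge0.
have qE : q ^+ m.+1 = g / f.
  by rewrite -powR_mulrn// -powRrM mulVf// powRr1// divr_ge0.
have sq s : 0 < s < 1 -> radial (lproj C) (s, y) -> 1 - s <= q.
  move=> s01 yP; have [s0 s1] : 0 < s /\ s < 1 by case/andP: s01.
  have : dilate s (lproj C) y by rewrite -radialE//; lra.
  move=> [p pP pE]; have := vol_fiber_ge bC s01 pP.
  rewrite pE fE gE -EFinM lee_fin -ler_pdivlMr// -qE.
  by rewrite ler_pXn2r ?nnegrE//; lra.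
rewrite muleC -lee_pdivlMr// -EFinM -qE.
have mr : measurable (radial (lproj C)).
  by apply: measurable_radial; apply: convex_body_measurable; exact: convex_body_lproj.
have m1 : measurable_fun [set: mR] (fun s => (\1_(radial (lproj C)) (s, y) : R)).
  exact: (measurableT_comp (measurable_indic mr) (measurable_pair2 y)).
have md := measurable_radial_density m.
(* [q] may exceed 1, when the fibre over [y] is larger than the central one; the interval is then
   all of [[0, 1]]. *)
pose a := Num.max 0 (1 - q).
have a01 : 0 <= a <= 1 by rewrite le_max lexx /= ge_max ler01 /=; lra.
have aq : (1 - a) ^+ m.+1 <= q ^+ m.+1.
  rewrite ler_pXn2r ?nnegrE//; last by case/andP: a01 => _ ?; rewrite subr_ge0.
  by rewrite lerBlDl -lerBlDr le_max lexx orbT.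
apply: (@le_trans _ _ ((1 - a) ^+ m.+1)%:E); last by rewrite lee_fin.
have ia : (\int[leb]_(s in `[a, 1%R]) (radial_density m s)%:E = ((1 - a) ^+ m.+1)%:E)%E.
  have [->|a1] := eqVneq a 1.
    by rewrite subrr expr0n /= set_itv1 integral_set1.
  by rewrite -integral_onemX_ge//; case/andP: a01 => -> ?; rewrite lt_neqAle a1.
rewrite -ia [leRHS]integral_mkcond; apply: ge0_le_integral => //.
- move=> s _; rewrite lee_fin indicE; case: (boolP (_ \in radial _)) => [|_]; last by rewrite mulr0.
  by rewrite inE => -[/andP[_ ?] _]; rewrite mulr1 radial_density_ge0.
- by apply/measurable_EFinP; apply: measurable_funM.
- apply/(measurable_restrictT _ _).1 => //.
  by apply/measurable_EFinP; apply: measurable_funTS.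
- move=> s _; rewrite patchE indicE; case: (boolP (_ \in radial _)) => [|_]; last first.
    rewrite mulr0; case: ifPn => // /set_mem /=; rewrite in_itv/= => /andP[_ s1].
    by rewrite lee_fin radial_density_ge0.
  rewrite inE => sr; have [/andP[/= s0 s1] _] := sr; rewrite mulr1 mem_set//= in_itv/= s1 andbT.
  rewrite ge_max ltW//=; have [->|sn1] := eqVneq s 1; first by lra.
  by have := sq s _ sr; rewrite s0 lt_neqAle sn1 s1 => /(_ isT); lra.
Qed.

(** After integration of [vol_fiber_ge_radial] over [y] and exchange of the integrals, each [s]
    contributes the volume of the projection dilated by [s], that is [s^k] times the original; the
    beta integral then gives the constant. *)
Lemma vol_lproj_fiber_le k m (C : set 'rV[R]_(k + m)) : convex_body C -> C 0 ->
  (vol (lproj C) * vol (fiber C 0) <= ('C(k + m, k)%:R)%:E * vol C)%E.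
Proof.
move=> bC C0; have bP := convex_body_lproj bC.
have mP := convex_body_measurable bP; have mC := convex_body_measurable bC.
case: m C bC C0 bP mP mC => [|m] C bC C0 bP mP mC.
  (* For [m = 0] there is no density; every nonempty fibre is the point of R^0, of mass 1. *)
  have -> : 'C(k + 0, k) = 1%N by rewrite addn0 binn.
  rewrite mul1e -[leRHS]mule1.
  apply: lee_pmul; rewrite ?vol_ge0//; last by rewrite /= lee_fin indicE; case: (_ \in _).
  rewrite vol_fibers// -[leLHS]mul1e.
  have -> : (1 * vol (lproj C) = \int[vol (n := k)]_y (\1_(lproj C) y)%:E)%E.
    by rewrite integral_indic// setIT mul1e.
  apply: ge0_le_integral => //.
  - by apply/measurable_EFinP; exact: measurable_indic.
  - exact: measurable_vol_fiber.
  - move=> y _; rewrite indicE; case: (boolP (y \in _)) => [|_]; last exact: vol_ge0.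
    rewrite inE => /fiber_lproj[z Cz]; rewrite /= indicE mem_set//.
    by rewrite -(thinmx0 z).
have mr := measurable_radial mP.
have mind : measurable_fun [set: mR * 'rV[R]_k]
    (fun p => (radial_density m p.1 * \1_(radial (lproj C)) p)%:E).
  apply/measurable_EFinP; apply: measurable_funM; last exact: measurable_indic.
  by apply: measurableT_comp; [exact: measurable_radial_density|exact: measurable_fst].
have ind0 p : (0 <= (radial_density m p.1 * \1_(radial (lproj C)) p)%:E)%E.
  rewrite lee_fin indicE; case: (boolP (p \in _)) => [|_]; last by rewrite mulr0.
  by rewrite inE => -[/andP[_ ?] _]; rewrite mulr1 radial_density_ge0.
pose cnk : R := 'C(k + m.+1, k)%:R.
have cnk0 : 0 < cnk by rewrite ltr0n bin_gt0 leq_addr.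
rewrite -lee_pdivrMl// [leRHS]vol_fibers//.
apply: (@le_trans _ _ (\int[vol (n := k)]_y (vol (fiber C 0) *
    \int[leb]_s (radial_density m s * \1_(radial (lproj C)) (s, y))%:E))%E); last first.
  apply: ge0_le_integral => //.
  - by move=> y _; rewrite mule_ge0 ?vol_ge0//; apply: integral_ge0 => s _; exact: (ind0 (s, y)).
  - apply: emeasurable_funM => //.
    exact: (measurable_fun_fubini_tonelli_G (m1 := leb) (fun p => (radial_density m p.1 * \1_(radial (lproj C)) p)%:E)).
  - exact: measurable_vol_fiber.
  - by move=> y _; exact: vol_fiber_ge_radial.
rewrite ge0_integralZl ?vol_ge0//; last 2 first.
- exact: (measurable_fun_fubini_tonelli_G (m1 := leb) (fun p => (radial_density m p.1 * \1_(radial (lproj C)) p)%:E)).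
- by move=> y _; apply: integral_ge0 => s _; exact: (ind0 (s, y)).
rewrite -(fubini_tonelli (m1 := leb) (m2 := @vol R k)
  (fun p => (radial_density m p.1 * \1_(radial (lproj C)) p)%:E))//.
rewrite muleA [leLHS]muleC; apply: lee_wpmul2l; first exact: vol_ge0.
have mden (D : set mR) : measurable_fun D (fun s => (radial_density m s * s ^+ k)%:E).
  apply/measurable_EFinP; apply: measurable_funTS; apply: measurable_funM; last exact: measurable_funX.
  exact: measurable_radial_density.
have den0 s : `]0%R, 1%R]%classic s -> (0 <= (radial_density m s * s ^+ k)%:E)%E.
  rewrite /= in_itv/= => /andP[s0 s1].
  by rewrite lee_fin mulr_ge0 ?radial_density_ge0// exprn_ge0// ltW.
rewrite -(integral_onemX_beta k m) muleC -integral_itv_obnd_cbnd; last exact: mden.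
have <- := @ge0_integralZl _ _ _ leb _ (measurable_itv `]0%R, 1%R]) _ (mden _) (vol (lproj C)) den0 (vol_ge0 _).
rewrite integral_mkcond; apply: ge0_le_integral => //.
- move=> s _; rewrite patchE; case: ifPn => // /set_mem s01.
  by rewrite mule_ge0 ?vol_ge0//; exact: den0.
- apply/(measurable_restrictT _ _).1 => //.
  by apply: measurable_funeM; exact: mden.
- exact: (@measurable_fun_fubini_tonelli_F _ _ _ _ _ (@vol R k) _ mind ind0).
move=> s _; rewrite patchE; case: ifPn => [/set_mem /=|_]; last first.
  by apply: integral_ge0 => y _; exact: (ind0 (s, y)).
rewrite in_itv/= => s01; have /andP[s0 s1] := s01.
under eq_integral do rewrite EFinM.
rewrite ge0_integralZl//; last 2 first.
- apply/measurable_EFinP.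
  exact: (measurableT_comp (measurable_indic mr) (measurable_pair1 (s : mR))).
- by rewrite lee_fin radial_density_ge0.
rewrite (eq_integral (fun y => (\1_(dilate s (lproj C)) y)%:E)); last first.
  by move=> y _; rewrite -radialE// !indicE; congr (_%:R%:E); congr nat_of_bool; apply/idP/idP; rewrite !inE.
rewrite integral_indic//; last first.
  by apply: convex_body_measurable; exact: convex_body_dilate.
rewrite setIT [X in (_ <= _ * X)%E](vol_dilate s0 mP) muleA -EFinM muleC.
by rewrite /radial_density.
Qed.

End projection_section_inequalities.

(** * Inequalities for the Wills functional *)

Section wills_inequalities.
Context {R : realType}.
Implicit Types n k m : nat.
Notation leb := (@lebesgue_measure R).
Notation mR := (measurableTypeR R).

(** As [a] and [b] decrease together, [(a s - a t) (b s - b t)] is nonnegative; it is integrated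
    over the unit square with the negative terms moved to the other side. *)
Lemma chebyshev_association (a b : R -> R) :
  measurable_fun (`]0, 1[%classic : set mR) a ->
  measurable_fun (`]0, 1[%classic : set mR) b ->
  (forall s, 0 <= a s) -> (forall s, 0 <= b s) ->
  (forall s t, 0 < s < 1 -> 0 < t < 1 -> s <= t -> a t <= a s /\ b t <= b s) ->
  (\int[leb]_(s in `]0%R, 1%R[) (a s)%:E * \int[leb]_(s in `]0%R, 1%R[) (b s)%:E <=
   \int[leb]_(s in `]0%R, 1%R[) (a s * b s)%:E)%E.
Proof.
move=> ma mb a0 b0 mono.
set A := (\int[leb]_(s in _) (a s)%:E)%E; set B := (\int[leb]_(s in _) (b s)%:E)%E.
set I := (\int[leb]_(s in _) (a s * b s)%:E)%E.
have mI : measurable (`]0%R, 1%R[%classic : set mR) by exact: measurable_itv.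
have A0 : (0 <= A)%E by apply: integral_ge0 => s _; rewrite lee_fin.
have B0 : (0 <= B)%E by apply: integral_ge0 => s _; rewrite lee_fin.
have I0 : (0 <= I)%E by apply: integral_ge0 => s _; rewrite lee_fin mulr_ge0.
have mEa : measurable_fun (`]0%R, 1%R[%classic : set mR) (EFin \o a) by apply/measurable_EFinP.
have mEb : measurable_fun (`]0%R, 1%R[%classic : set mR) (EFin \o b) by apply/measurable_EFinP.
have mEab : measurable_fun (`]0%R, 1%R[%classic : set mR) (fun s => (a s * b s)%:E).
  by apply/measurable_EFinP; apply: measurable_funM.
have leb1 : leb `]0%R, 1%R[%classic = 1%E.
  by have := lebesgue_measure_itv `]0%R, 1%R[ => /= ->; rewrite lte_fin ltr01 oppr0 adde0.
have mZr (c : \bar R) (f : mR -> \bar R) : measurable_fun (`]0%R, 1%R[%classic : set mR) f ->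
    measurable_fun (`]0%R, 1%R[%classic : set mR) (fun t => f t * c)%E.
  by move=> mf; apply: emeasurable_funM.
have mZl (c : \bar R) (f : mR -> \bar R) : measurable_fun (`]0%R, 1%R[%classic : set mR) f ->
    measurable_fun (`]0%R, 1%R[%classic : set mR) (fun t => c * f t)%E.
  by move=> mf; apply: emeasurable_funM.
have a0' s : (0 <= (a s)%:E)%E by rewrite lee_fin.
have b0' s : (0 <= (b s)%:E)%E by rewrite lee_fin.
have inner1 s : (\int[leb]_(t in `]0%R, 1%R[) (a s * b t + a t * b s)%:E =
    (a s)%:E * B + A * (b s)%:E)%E.
  under eq_integral do rewrite EFinD !EFinM.
  rewrite (ge0_integralD leb mI (fun t _ => mule_ge0 (a0' s) (b0' t)) (mZl _ _ mEb)
    (fun t _ => mule_ge0 (a0' t) (b0' s)) (mZr _ _ mEa)).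
  by rewrite (ge0_integralZl leb mI mEb (fun t _ => b0' t))// (ge0_integralZr leb mI mEa (fun t _ => a0' t)).
have inner2 s : (\int[leb]_(t in `]0%R, 1%R[) (a s * b s + a t * b t)%:E =
    (a s * b s)%:E + I)%E.
  under eq_integral do rewrite EFinD.
  rewrite ge0_integralD//; [|by move=> t _; rewrite lee_fin mulr_ge0..].
  by rewrite -/I integral_cst// [X in (_ * X)%E]leb1 mule1.
have outer1 : (\int[leb]_(s in `]0%R, 1%R[) ((a s)%:E * B + A * (b s)%:E) = A * B + A * B)%E.
  rewrite (ge0_integralD leb mI (fun t _ => mule_ge0 (a0' t) B0) (mZr _ _ mEa)
    (fun t _ => mule_ge0 A0 (b0' t)) (mZl _ _ mEb)).
  by rewrite (ge0_integralZr leb mI mEa (fun t _ => a0' t))// (ge0_integralZl leb mI mEb (fun t _ => b0' t)).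
have outer2 : (\int[leb]_(s in `]0%R, 1%R[) ((a s * b s)%:E + I) = I + I)%E.
  rewrite ge0_integralD//; last by move=> t _; rewrite lee_fin mulr_ge0.
  by rewrite -/I integral_cst// [X in (_ * X)%E]leb1 mule1.
(* The values may be infinite, so the factor 2 is removed by contradiction rather than by
   division. *)
suff : (A * B + A * B <= I + I)%E.
  have AB0 : (0 <= A * B)%E by exact: mule_ge0.
  by rewrite leNgt => /negP h; rewrite leNgt; apply/negP => IAB; apply: h; exact: lteD.
rewrite -outer1 -outer2; apply: ge0_le_integral => //.
- by move=> s _; rewrite adde_ge0// mule_ge0// lee_fin.
- by apply: emeasurable_funD; [exact: mZr|exact: mZl].
- by apply: emeasurable_funD.
move=> s s01; rewrite -inner1 -inner2; apply: ge0_le_integral => //.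
- by move=> t _; rewrite lee_fin addr_ge0// mulr_ge0.
- apply/measurable_EFinP; apply: measurable_funD; apply: measurable_funM => //.
- apply/measurable_EFinP; apply: measurable_funD; apply: measurable_funM => //.
move=> t t01; rewrite lee_fin; move: s01 t01; rewrite /= !in_itv/= => s01 t01.
rewrite -subr_ge0 (_ : _ - _ = (a s - a t) * (b s - b t)); last by ring.
have [st|/ltW ts] := leP s t.
  by have [h1 h2] := mono s t s01 t01 st; rewrite mulr_ge0// subr_ge0.
have [h1 h2] := mono t s t01 s01 ts.
by rewrite -mulrNN !opprB mulr_ge0// subr_ge0.
Qed.

(** Measurability is read off the polynomial in [radius s]. *)
Lemma measurable_parallel_volume n (K : set 'rV[R]_n) D : convex_body K -> K 0 ->
  measurable_fun D (fun s : mR => parallel_volume K (radius s)).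
Proof.
move=> bK K0; have [p sp pE] := parallel_volume_poly bK K0.
rewrite (_ : (fun s => _) = (fun s => \sum_(i < n.+1) p`_i * radius s ^+ i)); last first.
  by apply/funext => s; rewrite pE ?radius_ge0// (horner_coef_wide _ sp).
apply: measurable_sum => i; apply: measurable_funM => //.
by apply: measurable_funX; apply: measurable_funTS; exact: measurable_radius.
Qed.

Lemma gauss_willsE n (K : set 'rV[R]_n) : convex_body K ->
  gauss_wills K = (\int[leb]_(s in `]0%R, 1%R[) (parallel_volume K (radius s))%:E)%E.
Proof. by move=> bK; apply: eq_integral => s _; rewrite parallel_volumeE. Qed.

Lemma radius_anti (s t : R) : 0 < s < 1 -> 0 < t < 1 -> s <= t -> radius t <= radius s.
Proof.
move=> /andP[s0 s1] /andP[t0 t1] st; rewrite ler_wsqrtr// ler_pM2r ?invr_gt0 ?pi_gt0//.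
by rewrite lerN2 ler_ln.
Qed.

Lemma parallel_volume_mono n (K : set 'rV[R]_n) c d : convex_body K -> K 0 ->
  0 <= c -> c <= d -> parallel_volume K c <= parallel_volume K d.
Proof.
move=> bK K0 c0 cd; have := @parallel_volume_le R n K 1 c d bK K0.
by rewrite expr1n !mul1r; apply => //; exact: le_trans cd.
Qed.

Lemma gauss_wills_lproj_fiber_le k m (K : set 'rV[R]_(k + m)) : convex_body K -> K 0 ->
  (gauss_wills (lproj K) * gauss_wills (fiber K 0%R) <= ('C(k + m, k)%:R)%:E * gauss_wills K)%E.
Proof.
move=> bK K0.
have bP := convex_body_lproj bK.
have P0 : lproj K 0 by exists 0; rewrite // linear0.
have L0 : fiber K 0 0 by rewrite /fiber /= row_mx0.
have bL : convex_body (fiber K 0) by apply: convex_body_fiber => //; exists 0.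
apply: (@le_trans _ _ (\int[leb]_(s in `]0%R, 1%R[)
    (parallel_volume (lproj K) (radius s) * parallel_volume (fiber K 0) (radius s))%:E)%E).
  rewrite !gauss_willsE//; apply: chebyshev_association.
  - exact: measurable_parallel_volume.
  - exact: measurable_parallel_volume.
  - by move=> s; exact: parallel_volume_ge0.
  - by move=> s; exact: parallel_volume_ge0.
  - by move=> s t s01 t01 st; split; apply: parallel_volume_mono; rewrite ?radius_ge0 ?radius_anti.
rewrite gauss_willsE// -ge0_integralZl//; last 2 first.
- by apply/measurable_EFinP; exact: measurable_parallel_volume.
- by move=> s _; rewrite lee_fin parallel_volume_ge0.
apply: ge0_le_integral => //.
- by move=> s _; rewrite lee_fin mulr_ge0 ?parallel_volume_ge0.
- by apply/measurable_EFinP; apply: measurable_funM; exact: measurable_parallel_volume.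
- by apply: measurable_funeM; apply/measurable_EFinP; exact: measurable_parallel_volume.
move=> s _; have r0 := radius_ge0 s; move: (radius s) r0 => r r0.
rewrite EFinM -!parallel_volumeE//.
have bC := convex_body_parallel r bK.
have sub0 (A : set 'rV[R]_(k + m)) : A `<=` parallel_body A r.
  by move=> x Ax; apply/(parallel_bodyP _ _ r0); exists x; rewrite // subrr euclid_norm0.
apply: le_trans (vol_lproj_fiber_le bC (sub0 _ _ K0)).
have mfib : measurable (fiber (parallel_body K r) 0).
  by apply: compact_measurable_rV; apply: compact_fiber; case: bC.
(* A displacement of length at most [r] within one block of coordinates is also one in the whole
   space, so projection and fiber of the parallel body contain the parallel bodies of projection and
   fiber. *)
apply: lee_pmul; rewrite ?vol_ge0//; apply: le_vol => //.
- by apply: convex_body_measurable; exact: convex_body_parallel.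
- by apply: convex_body_measurable; exact: convex_body_lproj.
- move=> y /(parallel_bodyP _ _ r0)[p /fiber_lproj[w Kw] yp].
  apply/fiber_lproj; exists w; rewrite /fiber /=; apply/(parallel_bodyP _ _ r0).
  exists (row_mx p w) => //; rewrite opp_row_mx add_row_mx subrr.
  by rewrite -ler_sqr ?nnegrE ?euclid_norm_ge0// euclid_norm_row_mx euclid_norm0 expr0n addr0
     ler_sqr ?nnegrE ?euclid_norm_ge0.
- by apply: convex_body_measurable; exact: convex_body_parallel.
- move=> z /(parallel_bodyP _ _ r0)[q Kq zq].
  rewrite /fiber /=; apply/(parallel_bodyP _ _ r0).
  exists (row_mx 0 q) => //; rewrite opp_row_mx add_row_mx subr0.
  by rewrite -ler_sqr ?nnegrE ?euclid_norm_ge0// euclid_norm_row_mx euclid_norm0 expr0n add0r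
     ler_sqr ?nnegrE ?euclid_norm_ge0.
Qed.

Lemma integral_vol_translate n (a : 'rV[R]_n) (f : 'rV[R]_n -> \bar R) :
  measurable_fun setT f -> (forall x, 0 <= f x)%E ->
  (\int[vol (n := n)]_x f x = \int[vol (n := n)]_x f (x + a)%R)%E.
Proof.
move=> mf f0; have ms : measurable_fun [set: 'rV[R]_n] (fun x => x + a).
  by apply: measurable_addrV; [exact: measurable_id|exact: measurable_cst].
have <- := ge0_integral_pushforward ms (@vol R n) (D := setT) measurableT mf (fun x _ => f0 x).
by apply: eq_measure_integral => A mA _; exact/esym/(vol_translate a mA).
Qed.

Lemma gauss_wills_lproj_fiber_le_dilate k m (K : set 'rV[R]_(k + m)) : convex_body K -> K 0 ->
  (gauss_wills (lproj K) * gauss_wills (fiber K 0%R) <= gauss_wills (dilate 2%R K))%E.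
Proof.
move=> bK K0.
have bP := convex_body_lproj bK.
have L0 : fiber K 0 0 by rewrite /fiber /= row_mx0.
have bL : convex_body (fiber K 0) by apply: convex_body_fiber => //; exists 0.
have b2 := convex_body_dilate 2 bK.
have mE n (A : set 'rV[R]_n) : convex_body A -> measurable_fun setT (EFin \o gauss A).
  by move=> bA; apply/measurable_EFinP; exact: measurable_gauss.
have gE n (A : set 'rV[R]_n) x : (0 <= (gauss A x)%:E)%E by rewrite lee_fin ltW// gauss_gt0.
rewrite !integral_gauss// integral_vol_row_mx//; last exact: mE.
rewrite -ge0_integralZr//; last 2 first.
- exact: mE.
- by apply: integral_ge0 => x _; exact: gE.
have mrow : measurable_fun [set: 'rV[R]_k * 'rV[R]_m]
    (fun p => (gauss (dilate 2 K) (row_mx p.1 p.2))%:E).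
  exact: measurableT_comp (mE _ _ b2) (@measurable_row_mx R k m).
apply: ge0_le_integral => //.
- by move=> y _; rewrite mule_ge0//; apply: integral_ge0 => x _; exact: gE.
- by apply: emeasurable_funM => //; exact: mE.
- exact: (@measurable_fun_fubini_tonelli_F _ _ _ _ _ (@vol R m) _ mrow).
move=> y _.
(* The lift [w] is chosen once [y] is fixed, so the translation by [w] concerns the inner integral
   only. *)
have [P0 cP _] := bP; have [p /fiber_lproj[w Kw] pE] := euclid_distP y P0 cP.
have ms : measurable_fun [set: 'rV[R]_m] (fun z => z + w).
  by apply: measurable_addrV; [exact: measurable_id|exact: measurable_cst].
have my : measurable_fun [set: 'rV[R]_m] (fun z => (gauss (dilate 2 K) (row_mx y z))%:E).
  exact: measurableT_comp mrow (measurable_pair1 y).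
rewrite (integral_vol_translate w my); last by move=> z; exact: gE.
rewrite -ge0_integralZl//; last exact: mE.
apply: ge0_le_integral; first exact: measurableT.
- by move=> z _; apply: mule_ge0; exact: gE.
- by apply: measurable_funeM; exact: mE.
- exact: (measurableT_comp my ms).
move=> z _; rewrite -EFinM lee_fin /gauss -expRD ler_expR -opprD lerN2 -mulrDr.
rewrite ler_pM2l ?pi_gt0//.
have [LL0 cL _] := bL; have [q Kq qE] := euclid_distP z LL0 cL.
rewrite pE qE -euclid_norm_row_mx ler_sqr ?nnegrE ?euclid_dist_ge0 ?euclid_norm_ge0//.
have -> : row_mx (y - p) (z - q) = row_mx y (z + w) - (row_mx p w + row_mx 0 q).
  rewrite add_row_mx opp_row_mx add_row_mx addr0; congr row_mx.
  by apply/rowP => i; rewrite !mxE; ring.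
(* The midpoint of the two points is in [K] by convexity, and its double is their sum. *)
apply: euclid_dist_le; exists (2^-1 *: (row_mx p w + row_mx 0 q)).
  have [_ _ /convex_setP vK] := bK.
  have := vK _ _ 2^-1 Kw Kq; rewrite scalerDr (_ : 1 - 2^-1 = 2^-1); last by lra.
  by apply; lra.
by rewrite scalerA mulfV ?scale1r// pnatr_eq0.
Qed.

Lemma gauss_wills_dilate2_le n (K : set 'rV[R]_n) : convex_body K -> K 0 ->
  (gauss_wills (dilate 2%R K) <= (2 `^ (n%:R / 2))%:E * gauss_wills (dilate (Num.sqrt 2) K))%E.
Proof.
move=> bK K0; set q := Num.sqrt 2.
have q0 : 0 < q by rewrite sqrtr_gt0.
have q1 : 1 <= q by rewrite -sqrtr1 ler_sqrt// ler1n.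
have qq : q * q = 2 by rewrite -expr2 sqr_sqrtr.
(* The factor of the theorem is the volume ratio of a dilation by [q] in dimension [n]. *)
have -> : 2 `^ (n%:R / 2) = q ^+ n.
  by rewrite mulrC powRrM powR12_sqrt// powR_mulrn// ltW.
have b2 := convex_body_dilate 2 bK; have bq := convex_body_dilate q bK.
have dil0 c : dilate c K 0 by exists 0; rewrite // scaler0.
rewrite !gauss_willsE// -ge0_integralZl//; last 3 first.
- by apply/measurable_EFinP; exact: measurable_parallel_volume.
- by move=> s _; rewrite lee_fin parallel_volume_ge0.
- by rewrite lee_fin exprn_ge0// ltW.
apply: ge0_le_integral => //.
- by move=> s _; rewrite lee_fin parallel_volume_ge0.
- by apply/measurable_EFinP; exact: measurable_parallel_volume.
- by apply: measurable_funeM; apply/measurable_EFinP; exact: measurable_parallel_volume.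
move=> s _; have r0 := radius_ge0 s; move: (radius s) r0 => r r0.
have bqr := convex_body_parallel r bq.
rewrite -!parallel_volumeE// -vol_dilate//; last exact: convex_body_measurable.
apply: le_vol.
- by apply: convex_body_measurable; exact: convex_body_parallel.
- by apply: convex_body_measurable; exact: convex_body_dilate.
move=> x /(parallel_bodyP _ _ r0)[_ [y Ky <-] xy].
rewrite dilateE ?lt0r_neq0//=; apply/(parallel_bodyP _ _ r0).
exists (q *: y); first by exists y.
have -> : q *: y = q^-1 *: (2 *: y) by rewrite scalerA -qq mulrA mulVf ?mul1r// lt0r_neq0.
have qi : 0 <= q^-1 by rewrite invr_ge0 ltW.
rewrite -scalerBr euclid_normZ ger0_norm// ler_pdivrMl// (le_trans xy)//.
by rewrite ler_peMl.
Qed.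

End wills_inequalities.

(** * Coordinates adapted to a subspace and its orthogonal complement *)

Section orthogonal_coordinates.
Context {R : realType}.
Implicit Types n k m p : nat.

Lemma gauss_wills_mulmxr n (U : 'M[R]_n) (K : set 'rV[R]_n) : U *m U^T = 1%:M ->
  convex_body K -> gauss_wills [set x *m U | x in K] = gauss_wills K.
Proof.
move=> UU bK; apply: eq_integral => s _.
have ball : [set x *m U | x in unit_ball R n] = unit_ball R n.
  apply/seteqP; split => [_ [x x1 <-]|x x1]; first by rewrite /unit_ball/= euclid_norm_orthogonal.
  exists (x *m U^T); last by rewrite -mulmxA (mulmx1C UU) mulmx1.
  by rewrite /unit_ball/= euclid_norm_orthogonal// trmxK; exact: mulmx1C.
rewrite parallel_bodyE -{1}ball -dilate_mulmxr -msum_mulmxr -parallel_bodyE vol_mulmxr//.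
by apply: convex_body_measurable; exact: convex_body_parallel.
Qed.

(** Gram-Schmidt, one row at a time: as long as [j] is below the rank, some row of [W] lies outside
    the span of [A], and its normalised component orthogonal to [A] is adjoined. *)
Lemma exists_orthonormal_rows p n (W : 'M[R]_(p, n)) j : (j <= \rank W)%N ->
  exists2 A : 'M[R]_(j, n), A *m A^T = 1%:M & (A <= W)%MS.
Proof.
elim: j => [_|j IH jW]; first by exists 0; rewrite ?sub0mx// flatmx0 [RHS]flatmx0.
have [A AA AW] := IH (ltnW jW).
have /row_subPn[i iA] : ~~ (W <= A)%MS.
  by apply: contraL jW => /mxrankS WA; rewrite -leqNgt (leq_trans WA)// rank_leq_row.
pose h := row i W - row i W *m A^T *m A.
have hA : h *m A^T = 0 by rewrite mulmxBl -[_ *m A *m _]mulmxA AA mulmx1 subrr.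
have h0 : h != 0.
  by apply: contra iA; rewrite subr_eq0 => /eqP ->; exact: submxMl.
have hW : (h <= W)%MS.
  by rewrite addmx_sub ?row_sub// eqmx_opp (submx_trans (submxMl _ _) AW).
have nh : euclid_norm h != 0 by rewrite euclid_norm_eq0.
pose e := (euclid_norm h)^-1 *: h.
have ee : e *m e^T = 1%:M.
  rewrite [LHS]mx11_scalar -dotE /e dotZl dotZr -sqr_euclid_norm expr2.
  by move: (euclid_norm h) nh => r r0; congr (_%:M); field.
have eA : e *m A^T = 0 by rewrite -scalemxAl hA scaler0.
have cW : (col_mx e A <= W)%MS.
  by rewrite col_mx_sub AW (submx_trans (scalemx_sub _ (submx_refl h))).
have Ae : A *m e^T = 0 by apply: trmx_inj; rewrite trmx_mul trmxK eA trmx0.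
have cc : col_mx e A *m (col_mx e A)^T = 1%:M.
  by rewrite tr_col_mx mul_col_row ee eA AA Ae -scalar_mx_block.
by exists (col_mx e A).
Qed.

Lemma vspace_rows n (H : {vspace 'rV[R]_n}) :
  exists2 W : 'M[R]_(\dim H, n), \rank W = \dim H & forall x, (x \in H) = (x <= W)%MS.
Proof.
pose W : 'M[R]_(\dim H, n) := \matrix_i ((vbasis H)`_i : 'rV[R]_n).
have rowW i : row i W = (vbasis H)`_i by rewrite rowK.
exists W.
  apply/eqP; apply: inj_row_free => v; rewrite mulmx_sum_row => v0.
  apply/rowP => i; rewrite mxE.
  have /freeP fb := basis_free (vbasisP H).
  by apply: (fb (fun i => v ord0 i)); rewrite -[RHS]v0; apply: eq_bigr => j _; rewrite rowW.
move=> x; apply/idP/idP => [xH|/submxP[D ->]].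
  rewrite (coord_vbasis xH); apply: summx_sub => i _; apply: scalemx_sub.
  by rewrite -rowW row_sub.
rewrite mulmx_sum_row; apply: memv_suml => i _; apply: memvZ.
by rewrite rowW vbasis_mem// mem_nth// size_tuple.
Qed.

(* [x *m A^T] and [x *m B^T] are the coordinates of [x] along [H] and along its
   orthogonal complement. *)
Lemma exists_adapted_coordinates k m (H : {vspace 'rV[R]_(k + m)}) : \dim H = k ->
  exists A : 'M[R]_(k, k + m), exists B : 'M[R]_(m, k + m),
    [/\ row_mx A^T B^T *m (row_mx A^T B^T)^T = 1%:M,
        forall x : 'rV[R]_(k + m), (x \in H) = (x *m B^T == 0) &
        forall x : 'rV[R]_(k + m), ortho_compl H x <-> x *m A^T = 0].
Proof.
move=> dimH; have [W rW HW] := vspace_rows H.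
have [|A AA AW] := @exists_orthonormal_rows _ _ W k; first by rewrite rW dimH.
have rA : \rank A = k by apply/eqP/row_freeP; exists A^T.
have HA x : (x \in H) = (x <= A)%MS.
  have WA : (W <= A)%MS by rewrite -(mxrank_leqif_sup AW) rA rW dimH.
  by rewrite HW; apply/idP/idP => h; apply: submx_trans h _.
(* An orthonormal basis of the complement: the kernel of [A^T] has rank [k + m - k = m]. *)
have [|B BB BA] := @exists_orthonormal_rows _ _ (kermx A^T) m.
  by rewrite mxrank_ker mxrank_tr rA addKn.
have BA0 : B *m A^T = 0 by apply/sub_kermxP.
have AB0 : A *m B^T = 0 by apply: trmx_inj; rewrite trmx_mul trmxK BA0 trmx0.
have UU : row_mx A^T B^T *m (row_mx A^T B^T)^T = 1%:M.
  apply: mulmx1C; rewrite tr_row_mx !trmxK mul_col_row AA BB AB0 BA0.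
  by rewrite -scalar_mx_block.
exists A, B; split => // x.
  rewrite HA; apply/idP/eqP => [/submxP[D ->]|xB]; first by rewrite -mulmxA AB0 mulmx0.
  rewrite -(mulmx1 x) -UU tr_row_mx !trmxK mulmxA mul_mx_row mul_row_col xB mul0mx addr0.
  exact: submxMl.
split=> [xH|xA h].
  apply/rowP => i; rewrite !mxE -[RHS](xH (row i A)).
    by apply: eq_bigr => j _; rewrite !mxE.
  by rewrite HA row_sub.
by rewrite HA => /submxP[D ->]; rewrite dotE trmx_mul mulmxA xA mul0mx mxE.
Qed.

(** The projection and the section are recognised as convex bodies through their images, which are
    products. *)
Lemma convex_body_orthogonal_image n (U : 'M[R]_n) (S : set 'rV[R]_n) :
  U *m U^T = 1%:M -> convex_body [set x *m U | x in S] -> convex_body S.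
Proof.
move=> UU /(convex_body_mulmxr U^T); rewrite (_ : [set _ | _ in _] = S)//.
apply/seteqP; split => [_ [_ [x Sx <-] <-]|x Sx].
  by rewrite -mulmxA UU mulmx1.
by exists (x *m U); [exists x|rewrite -mulmxA UU mulmx1].
Qed.

Lemma wills_proj_section_le k m (K : set 'rV[R]_(k + m)) (H : {vspace 'rV[R]_(k + m)}) :
  convex_body K -> K 0 -> \dim H = k ->
  wills (ortho_proj H K) * wills (K `&` ortho_compl H) <=
  Num.min ('C(k + m, k)%:R * wills K)
          (2 `^ ((k + m)%:R / 2) * wills (dilate (Num.sqrt 2) K)).
Proof.
move=> bK K0 dimH; have [A [B [UU HB HA]]] := exists_adapted_coordinates dimH.
set U := row_mx A^T B^T in UU; have xU x : x *m U = row_mx (x *m A^T) (x *m B^T) by rewrite mul_mx_row.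
have [AA AB] : A *m A^T = 1%:M /\ A *m B^T = 0.
  by have := mulmx1C UU; rewrite tr_row_mx !trmxK mul_col_row scalar_mx_block => /eq_block_mx[].
pose K' := [set x *m U | x in K].
have bK' : convex_body K' by exact: convex_body_mulmxr.
have K'0 : K' 0 by exists 0; rewrite // mul0mx.
have bP := convex_body_lproj bK'.
have L0 : fiber K' 0 0 by rewrite /fiber /= row_mx0.
have bL : convex_body (fiber K' 0) by apply: convex_body_fiber => //; exists 0.
have projE : [set x *m U | x in ortho_proj H K] = set_prod (lproj K') [set 0].
  apply/seteqP; split => [_ [y [yH [x Kx /HA xyA]] <-]|_ [_ [_ [x Kx <-] <-] [_ -> <-]]].
    exists (y *m A^T).
      exists (x *m U); first by exists x.
      by rewrite xU row_mxKl; apply/eqP; rewrite -subr_eq0 -mulmxBl xyA.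
    by exists 0 => //; rewrite xU; congr row_mx; move: yH; rewrite HB => /eqP.
  rewrite xU row_mxKl.
  exists (x *m A^T *m A); last by rewrite xU -!mulmxA AA AB !mulmx1 !mulmx0.
  split; first by rewrite HB -!mulmxA AB !mulmx0.
  by exists x => //; apply/HA; rewrite mulmxBl -!mulmxA AA mulmx1 subrr.
have secE : [set x *m U | x in K `&` ortho_compl H] = set_prod [set 0] (fiber K' 0).
  apply/seteqP; split => [_ [x [Kx /HA xA] <-]|_ [_ -> [z [x Kx xz] <-]]].
    exists 0 => //; exists (x *m B^T); last by rewrite xU xA.
    by exists x => //; rewrite xU xA.
  exists x => //; split => //; apply/HA.
  by have := congr1 lsubmx xz; rewrite xU !row_mxKl.
have b0 n : convex_body [set (0 : 'rV[R]_n)] by exact: convex_body_set0.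
have bproj : convex_body (ortho_proj H K).
  apply: (convex_body_orthogonal_image UU); rewrite projE.
  exact: convex_body_set_prod.
have bsec : convex_body (K `&` ortho_compl H).
  apply: (convex_body_orthogonal_image UU); rewrite secE.
  exact: convex_body_set_prod.
have c0 : ortho_compl H 0 by move=> h _; rewrite dot0l.
have proj0 : ortho_proj H K 0 by split; [exact: mem0v|exists 0 => //; rewrite subr0].
(* [wills] is evaluated in the ambient space; rotation turns the set into a product with [{0}],
   whose factor 1 leaves an integral over R^k here and over R^m in [W2]. *)
have W1 : (wills (ortho_proj H K))%:E = gauss_wills (lproj K').
  by rewrite wills_gauss// -(gauss_wills_mulmxr UU)// projE gauss_wills_prod// gauss_wills_set0 mule1.
have W2 : (wills (K `&` ortho_compl H))%:E = gauss_wills (fiber K' 0).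
  by rewrite wills_gauss// -(gauss_wills_mulmxr UU)// secE gauss_wills_prod// gauss_wills_set0 mul1e.
have W3 : (wills K)%:E = gauss_wills K' by rewrite wills_gauss// -(gauss_wills_mulmxr UU).
have W4 : (wills (dilate (Num.sqrt 2) K))%:E = gauss_wills (dilate (Num.sqrt 2) K').
  rewrite wills_gauss; last 2 first.
  - exact: convex_body_dilate.
  - by exists 0; rewrite // scaler0.
  by rewrite -(gauss_wills_mulmxr UU) ?dilate_mulmxr//; exact: convex_body_dilate.
rewrite le_min -!lee_fin !EFinM W1 W2 W3 W4; apply/andP; split.
  exact: gauss_wills_lproj_fiber_le.
apply: le_trans (gauss_wills_dilate2_le bK' K'0).
exact: gauss_wills_lproj_fiber_le_dilate.
Qed.

End orthogonal_coordinates.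

Theorem theorem1p7 (R : realType) (n k : nat) (K : set 'rV[R]_n)
    (H : {vspace 'rV[R]_n})
    (bodyK : convex_body K) (K0 : K 0) (dimH : \dim H = k) :
  wills (ortho_proj H K) * wills (K `&` ortho_compl H) <=
  Num.min ('C(n, k)%:R * wills K)
          (2 `^ (n%:R / 2) * wills (dilate (Num.sqrt 2) K)).
Proof.
(* The ambient dimension is split so that [row_mx] coordinates can be used; [k] is at most [n],
   being the dimension of a subspace. *)
have [m nE] : exists m, n = (k + m)%N.
  exists (n - k)%N; rewrite subnKC// -dimH (leq_trans (dimvS (subvf H)))//.
  by rewrite dimvf /dim /= mul1n.
by subst n; exact: wills_proj_section_le.
Qed.
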